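(* Let $q_1,q_2,Y_1,Y_2,\rho>0$, and consider the continuous-time price system $\dot p_i=F_i(p_1,p_2)$, $i=1,2$, for prices $p_1,p_2\ge0$, where $$F_i(p_1,p_2)=-p_i\,\frac{q_i-q_i^{cons}}{q_i}+\frac{Y_i-Y_i^{cons}}{q_i}.$$ The only equilibrium points of this system are those on the hyperbolae $p_1=h_3(p_2)$ (its arc with $0\le p_1<\frac{Y_1}{q_1}$, $p_2>\frac{Y_2}{q_2}$) and $p_2=h_4(p_1)$ (its arc with $p_1>\frac{Y_1}{q_1}$, $0\le p_2<\frac{Y_2}{q_2}$), including their common point $\tilde E=\left(\frac{Y_1}{q_1},\frac{Y_2}{q_2}\right)$. These equilibrium points are Lyapunov stable but not asymptotically stable; asymptotic stability does not in general hold even for the point $\tilde E$.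
   Context: Model. Fix $q_1,q_2>0$ (quantities supplied in regions I and II), $Y_1,Y_2>0$ (incomes of consumers I and II) and $\rho>0$ (transportation cost). For prices $p_1,p_2\ge0$ write $p_i'=p_i+\rho$. At each moment the following game is played. Consumer I chooses $(\alpha,\beta)\in S_1=\{\alpha,\beta\ge0,\ \alpha p_1+\beta p_2'\le Y_1\}$ (orders in regions I and II); consumer II chooses $(\gamma,\delta)\in S_2=\{\gamma,\delta\ge0,\ \gamma p_1'+\delta p_2\le Y_2\}$ (orders in regions I and II). Payoffs: $U_1=\min(\alpha,q_1)+\min(\beta,\max(0,q_2-\delta))$ and $U_2=\min(\delta,q_2)+\min(\gamma,\max(0,q_1-\alpha))$. Selected best replies. Given $(\gamma,\delta)$, consumer I's best reply is the maximizer of $U_1$ over $S_1$ that among all maximizers minimizes the expenditure $p_1\alpha+p_2'\beta$ and, among those, has the largest home order $\alpha$; if $p_1=0$ the home order is instead set to $\alpha=q_1$. Given $(\alpha,\beta)$, consumer II's best reply is the maximizer of $U_2$ over $S_2$ that minimizes $p_1'\gamma+p_2\delta$ and, among those, has the largest home order $\delta$; if $p_2=0$ the home order is set to $\delta=q_2$. A Nash equilibrium (NE) at prices $(p_1,p_2)$ is a quadruple $(\alpha_0,\beta_0,\gamma_0,\delta_0)$ in which each consumer's orders are the selected best reply to the other's. With the NE at $(p_1,p_2)$ put $q_1^{cons}=\alpha_0+\gamma_0$, $q_2^{cons}=\beta_0+\delta_0$, $Y_1^{cons}=p_1\alpha_0+p_2'\beta_0$, $Y_2^{cons}=p_1'\gamma_0+p_2\delta_0$;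 these are functions of $(p_1,p_2)$. The right-hand side of the system may be discontinuous (along the lines $p_2=p_1\pm\rho$); a trajectory that hits a discontinuity line and stays on it is understood as in Filippov's theory of differential equations with discontinuous right-hand side. Hyperbolae: $h_3(p_2)=\frac1{q_1}\left(Y_1+Y_2-\rho q_2-p_2q_2+\frac{\rho}{p_2}Y_2\right)$ and $h_4(p_1)=\frac1{q_2}\left(Y_1+Y_2-\rho q_1-p_1q_1+\frac{\rho}{p_1}Y_1\right)$. *)

(* Defs.v *)
From HB Require Import structures.
From mathcomp Require Import all_boot all_order all_algebra.
From mathcomp Require Import all_classical all_reals all_analysis.
Import Order.TTheory GRing.Theory Num.Theory.
Import numFieldNormedType.Exports.

Set Implicit Arguments.
Unset Strict Implicit.
Unset Printing Implicit Defensive.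

Local Open Scope classical_set_scope.
Local Open Scope ring_scope.

(* Pairs of prices, of orders (home and foreign region in the order I, II), and
   of price velocities.  R^o makes the plane a normed R-module (max norm). *)
Notation plane R := (R^o * R^o)%type.

Section game.
Variable R : realType.
Variables q1 q2 Y1 Y2 rho : R.
Implicit Types (p o r : plane R).

(* The consumer's own orders are o, those of the other consumer are r. *)
Definition U1 r o : R :=
  Num.min o.1 q1 + Num.min o.2 (Num.max 0 (q2 - r.2)).

Definition U2 r o : R :=
  Num.min o.2 q2 + Num.min o.1 (Num.max 0 (q1 - r.1)).

Definition cost1 p o : R := p.1 * o.1 + (p.2 + rho) * o.2.

Definition cost2 p o : R := (p.1 + rho) * o.1 + p.2 * o.2.

Definition S1 p : set (plane R) :=
  [set o | [/\ 0 <= o.1, 0 <= o.2 & cost1 p o <= Y1]].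

Definition S2 p : set (plane R) :=
  [set o | [/\ 0 <= o.1, 0 <= o.2 & cost2 p o <= Y2]].

Definition maximizers (S : set (plane R)) (f : plane R -> R) : set (plane R) :=
  [set o | S o /\ forall o', S o' -> f o' <= f o].

(* When the home price is 0 the home order is not bounded by the budget, so
   there is no largest one; it is then fixed to be the home supply. *)
Definition selected_replies (S : set (plane R)) (U cost home : plane R -> R)
    (home_price home_supply : R) : set (plane R) :=
  let cheapest := maximizers (maximizers S U) (fun o => - cost o) in
  if home_price == 0 then cheapest `&` [set o | home o = home_supply]
  else maximizers cheapest home.

Definition best_reply1 p r : set (plane R) :=
  selected_replies (S1 p) (U1 r) (cost1 p) fst p.1 q1.

Definition best_reply2 p r : set (plane R) :=
  selected_replies (S2 p) (U2 r) (cost2 p) snd p.2 q2.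

(* ((alpha, beta), (gamma, delta)) *)
Definition nash p : set (plane R * plane R) :=
  [set s | best_reply1 p s.2 s.1 /\ best_reply2 p s.1 s.2].

(* At nonnegative prices there is exactly one Nash equilibrium, so the default
   value of xget plays no role there. *)
Definition the_nash p : plane R * plane R := xget ((0, 0), (0, 0)) (nash p).

Definition q1cons p : R := (the_nash p).1.1 + (the_nash p).2.1.
Definition q2cons p : R := (the_nash p).1.2 + (the_nash p).2.2.
Definition Y1cons p : R := cost1 p (the_nash p).1.
Definition Y2cons p : R := cost2 p (the_nash p).2.

Definition price_field p : plane R :=
  (- p.1 * ((q1 - q1cons p) / q1) + (Y1 - Y1cons p) / q1,
   - p.2 * ((q2 - q2cons p) / q2) + (Y2 - Y2cons p) / q2).

Definition h3 (p2 : R) : R :=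
  q1^-1 * (Y1 + Y2 - rho * q2 - p2 * q2 + rho / p2 * Y2).

Definition h4 (p1 : R) : R :=
  q2^-1 * (Y1 + Y2 - rho * q1 - p1 * q1 + rho / p1 * Y1).

Definition Etilde : plane R := (Y1 / q1, Y2 / q2).

Definition arc3 : set (plane R) :=
  [set p | [/\ p.1 = h3 p.2, 0 <= p.1 < Y1 / q1 & Y2 / q2 < p.2]].

Definition arc4 : set (plane R) :=
  [set p | [/\ p.2 = h4 p.1, Y1 / q1 < p.1 & 0 <= p.2 < Y2 / q2]].

End game.

Definition nonneg_prices (R : realType) : set (plane R) :=
  [set p | 0 <= p.1 /\ 0 <= p.2].

Section filippov.
Variable R : realType.
Variables (D : set (plane R)) (f : plane R -> plane R).
Implicit Types (p v : plane R) (x : R -> plane R) (T : R).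

Definition closed_convex_hull (A : set (plane R)) : set (plane R) :=
  smallest [set C : set (plane R) | closed C /\ convex_set C] A.

Definition plane_negligible (N : set (plane R)) : Prop :=
  (@lebesgue_measure R \x @lebesgue_measure R)%E.-negligible
    (N : set (measurableTypeR R * measurableTypeR R)).

(* Filippov's convexification of f, for a field f that is only meaningful on
   the state space D. *)
Definition filippov p : set (plane R) :=
  [set v | forall (d : R) (N : set (plane R)), 0 < d -> plane_negligible N ->
     closed_convex_hull (f @` ((ball p d `&` D) `\` N)) v].

Definition absolutely_continuous (a b : R) x : Prop :=
  forall e : R, 0 < e -> exists2 d : R, 0 < d &
    forall (n : nat) (s t : 'I_n -> R),
      (forall i, [/\ a <= s i, s i <= t i & t i <= b]) ->
      (forall i j, i != j -> t i <= s j \/ t j <= s i) ->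
      \sum_(i < n) (t i - s i) < d ->
      \sum_(i < n) `|x (t i) - x (s i)| < e.

(* x is a Filippov solution of x' = f x on [0, T] that remains in D *)
Definition solution_upto T x : Prop :=
  [/\ absolutely_continuous 0 T x,
      (forall t, 0 <= t <= T -> D (x t)) &
      {ae @lebesgue_measure R, forall t : R, 0 < t < T ->
         exists2 v, filippov (x t) v & is_derive (t : R^o) (1 : R^o) x v}].

Definition solution x : Prop := forall T, 0 < T -> solution_upto T x.

Definition zeros : set (plane R) := [set p | D p /\ f p = 0].

Definition filippov_equilibria : set (plane R) :=
  [set p | D p /\ filippov p 0].

(* Solutions on bounded time intervals are included, so that a solution
   starting near p cannot leave the neighbourhood before ceasing to exist. *)
Definition lyapunov_stable p : Prop :=
  forall e : R, 0 < e -> exists2 d : R, 0 < d &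
    forall T x, solution_upto T x -> `|x 0 - p| < d ->
      forall t, 0 <= t <= T -> `|x t - p| < e.

Definition attractive p : Prop :=
  exists2 d : R, 0 < d &
    forall x, solution x -> `|x 0 - p| < d -> x t @[t --> +oo] --> p.

Definition asymptotically_stable p : Prop := lyapunov_stable p /\ attractive p.

End filippov.

(* Main.v *)
Require Import Defs.
From mathcomp Require Import all_boot all_order all_algebra.
From mathcomp Require Import all_classical all_reals all_analysis.
From mathcomp Require Import ring lra.
Import Order.TTheory GRing.Theory Num.Theory.
Import numFieldNormedType.Exports.
Set Implicit Arguments.
Unset Strict Implicit.
Unset Printing Implicit Defensive.
Local Open Scope classical_set_scope.
Local Open Scope ring_scope.

(** Write be for the order of consumer I in region II and ga for the order of
    consumer II in region I.  At a Nash equilibrium these two import orders are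
    all that matters: q1 F1 = Y1 - p1 q1 + p1 ga - (p2 + rho) be, and
    symmetrically for q2 F2.  A best reply solves a fractional knapsack problem,
    so it is greedy: buy the cheaper good first ([selectedP]).  It follows that
    imports never exceed the [shortfall], the supply that the local consumer
    cannot afford, and that a consumer who can pay for all the home supply either
    imports the whole shortfall of the other region or spends at least the income
    remaining after that on imports ([nash_imports]).

    Let [excess] be the sum over both regions of
    Y_i - p_i q_i - rho * shortfall_i.  It is continuous, strictly decreasing in
    each price, and it governs the field ([price_field_sign]): where it is
    nonnegative, both velocities are nonnegative and q1 F1 + q2 F2 equals it;
    where it is nonpositive, both velocities are nonpositive and q1 F1 + q2 F2
    lies between it and a fixed positive multiple of it.  Hence the field
    vanishes exactly on the zero set of the excess, which is the union of the two
    arcs and of their common point ([excess_zeros]).  The field may jump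
    elsewhere, but tends to 0 at that curve, so the same signs hold for the vectors of
    Filippov's convexification, and 0 is one of these exactly on the curve
    ([filippov_sign], [filippov_zero_excess], [excess_zero_filippov]).

    Along a Filippov solution the excess cannot change sign: where it is
    negative, say, both prices fall, which raises it back towards 0.  So both
    prices are monotone, and as the excess decreases with slope at least q_i in
    p_i, they move in total by at most the initial excess: q1 |x1(t) - x1(0)| +
    q2 |x2(t) - x2(0)| <= |excess (x 0)| ([trajectory_bound]).  This gives Lyapunov
    stability.  An equilibrium is not attractive because the curve has no isolated
    points and each of its points is a constant solution
    ([excess_zero_not_isolated]). *)

(** * Greedy replies to a budget constraint *)

Lemma le_or_lt (R : realType) (x y : R) : x <= y \/ y < x.
Proof. by case: (leP x y); [left|right]. Qed.

Lemma min_cases (R : realType) (x y : R) :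
  x <= y /\ Num.min x y = x \/ y < x /\ Num.min x y = y.
Proof. by case: (leP x y); [left|right]. Qed.

Section knapsack.
Variable R : realType.
Variables a b H A Y : R.

(** Complementary slackness for buying x <= H at home at price a and y <= A abroad
    at price b with income Y: the dearer good is bought only once the cheaper one is
    exhausted, and money is left over only if both goods are exhausted.  At equal
    prices the home good comes first. *)
Definition greedy (x y : R) : Prop :=
  [/\ 0 <= x <= H, 0 <= y <= A, a * x + b * y <= Y &
      if a <= b then (x = H /\ (y = A \/ a * x + b * y = Y)) \/
                     (a * x = Y /\ y = 0)
      else (y = A /\ (x = H \/ a * x + b * y = Y)) \/ (b * y = Y /\ x = 0)].

(** The three clauses are the three criteria of the selection: number of units,
    expenditure among the bundles with as many units, home order among those with
    the same expenditure. *)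
Lemma greedy_optimal (x y x' y' : R) :
  0 <= a -> 0 < b -> 0 < Y -> greedy x y ->
  0 <= x' <= H -> 0 <= y' <= A -> a * x' + b * y' <= Y ->
  x' + y' <= x + y /\
  (x' + y' = x + y -> a * x + b * y <= a * x' + b * y' /\
    (a * x' + b * y' = a * x + b * y -> x' <= x)).
Proof.
move=> a_ge0 b_gt0 Y_gt0.
case=> /andP[x0 xH] /andP[y0 yA] bud gr /andP[x'0 x'H] /andP[y'0 y'A] bud'.
have [ab|ba] := le_or_lt a b; [rewrite ab in gr|rewrite (leNgt a b) ba /= in gr].
- case: gr => [[-> [->|sat]]|[sat ->]].
  + by split; [lra|move=> e; have [-> ->] : x' = H /\ y' = A by split; lra].
  + have h : 0 <= (b - a) * (H - x') by apply: mulr_ge0; lra.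
    split.
      rewrite -(ler_pM2l b_gt0); lra.
    move=> e; have e' : b * (x' + y') = b * (H + y) by rewrite e.
    by split; lra.
  + have a0 : 0 < a.
      rewrite lt_neqAle a_ge0 andbT eq_sym; apply/eqP => a0.
      by move: sat; rewrite a0 mul0r => sat; move: Y_gt0; rewrite -sat ltxx.
    have h : 0 <= (b - a) * y' by apply: mulr_ge0; lra.
    have x'x : x' <= x by rewrite -(ler_pM2l a0); have := mulr_ge0 (ltW b_gt0) y'0; lra.
    split; first by rewrite -(ler_pM2l a0); lra.
    move=> e; have e' : a * (x' + y') = a * (x + 0) by rewrite e.
    split; [lra|done].
- have a0 : 0 < a by lra.
  case: gr => [[-> [->|sat]]|[sat ->]].
  + by split; [lra|move=> e; have [-> ->] : x' = H /\ y' = A by split; lra].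
  + have h : 0 <= (a - b) * (A - y') by apply: mulr_ge0; lra.
    split.
      rewrite -(ler_pM2l a0); lra.
    move=> e; have e' : a * (x' + y') = a * (x + A) by rewrite e.
    split; first lra.
    move=> e2; have : (a - b) * (A - y') = 0 by lra.
    by move/eqP; rewrite mulf_eq0 => /orP[] /eqP; lra.
  + have h : 0 <= (a - b) * x' by apply: mulr_ge0; lra.
    split; first by rewrite -(ler_pM2l b_gt0); lra.
    move=> e; have e' : b * (x' + y') = b * (0 + y) by rewrite e.
    split; first lra.
    move=> e2; have : (a - b) * x' = 0 by lra.
    by move/eqP; rewrite mulf_eq0 => /orP[] /eqP; lra.
Qed.
End knapsack.

Section greedy_exists.
Variable R : realType.
Variables a b H Y : R.

(** The home order comes before the amount A left in the other region, which may
    therefore depend on it; this breaks the circularity in [nash_exists]. *)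
Lemma greedy_home_first :
  0 <= a -> 0 < b -> 0 < H -> 0 < Y -> a <= b ->
  exists x, forall A, 0 <= A -> exists y, greedy a b H A Y x y.
Proof.
move=> a_ge0 b_gt0 H_gt0 Y_gt0 ab; have [aHY|YaH] := le_or_lt (a * H) Y.
  exists H => A A0; exists (Num.min A ((Y - a * H) / b)).
  have : b * ((Y - a * H) / b) = Y - a * H by field; lra.
  have : 0 <= (Y - a * H) / b by apply: divr_ge0; lra.
  move: ((Y - a * H) / b) => z z0 zE; rewrite /greedy ab.
  have : 0 <= b * (z - Num.min A z) by apply: mulr_ge0; [lra|by case: (min_cases A z) => -[? ->]; lra].
  by case: (min_cases A z) => -[? ->] ?; split; first [lra | left; split; [|lra || (right; lra)|left]].
have a0 : 0 < a.
  by rewrite lt_neqAle a_ge0 andbT eq_sym; apply/eqP => a0; move: YaH; rewrite a0; lra.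
exists (Y / a) => A A0; exists 0; rewrite /greedy ab.
have e : a * (Y / a) = Y by field; lra.
have : 0 <= Y / a by apply: divr_ge0; lra.
have : Y / a <= H by rewrite ler_pdivrMr // mulrC ltW.
by split; lra.
Qed.

Lemma greedy_away_first A :
  0 < b -> 0 < H -> 0 < Y -> 0 <= A -> b < a -> exists x y, greedy a b H A Y x y.
Proof.
move=> b_gt0 H_gt0 Y_gt0 A0 ba; have a0 : 0 < a by lra.
have [bAY|YbA] := le_or_lt (b * A) Y.
  exists (Num.min H ((Y - b * A) / a)), A.
  have : a * ((Y - b * A) / a) = Y - b * A by field; lra.
  have : 0 <= (Y - b * A) / a by apply: divr_ge0; lra.
  move: ((Y - b * A) / a) => z z0 zE; rewrite /greedy (leNgt a b) ba /=.
  have : 0 <= a * (z - Num.min H z) by apply: mulr_ge0; [lra|by case: (min_cases H z) => -[? ->]; lra].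
  by case: (min_cases H z) => -[? ->] ?; split; lra.
exists 0, (Y / b); rewrite /greedy (leNgt a b) ba /=.
have e : b * (Y / b) = Y by field; lra.
have : 0 <= Y / b by apply: divr_ge0; lra.
have : Y / b <= A by rewrite ler_pdivrMr // mulrC ltW.
by split; lra.
Qed.

End greedy_exists.

(** The selection rule, for a consumer whose home order is the coordinate [home]
    of the bundle; the two consumers differ by the order of the coordinates. *)
Section selected.
Variable R : realType.
Variables (home away : plane R -> R) (S : set (plane R)) (U cost : plane R -> R).
Variables a b H A Y : R.
Hypothesis costE : forall o, cost o = a * home o + b * away o.
Hypothesis SE : forall o,
  S o <-> [/\ 0 <= home o, 0 <= away o & cost o <= Y].
Hypothesis UE : forall o, U o = Num.min (home o) H + Num.min (away o) A.
Hypothesis pair_surj : forall x y, exists2 o, home o = x & away o = y.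

Lemma greedy_selected o :
  0 <= a -> 0 < b -> 0 < H -> 0 <= A -> 0 < Y -> greedy a b H A Y (home o) (away o) ->
  selected_replies S U cost home a H o.
Proof.
move=> a_ge0 b_gt0 H_gt0 A_ge0 Y_gt0 gr; have [/andP[x0 xH] /andP[y0 yA] bud g3] := gr.
have So : S o by apply/SE; rewrite costE.
have Uo : U o = home o + away o by rewrite UE !min_l.
(* Orders beyond the available amounts cost money and bring nothing, so any
   bundle may be cut down to these amounts. *)
have clip o' : S o' -> let x := Num.min (home o') H in let y := Num.min (away o') A in
   [/\ 0 <= x <= H, 0 <= y <= A, a * x + b * y <= Y,
       a * x <= a * home o' & b * y <= b * away o'].
  move=> /SE [h1 h2]; rewrite costE => h3 x y.
  have xl : x <= home o' by rewrite ge_min lexx.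
  have yl : y <= away o' by rewrite ge_min lexx.
  have ? : a * x <= a * home o' by apply: ler_wpM2l.
  have ? : b * y <= b * away o' by apply: ler_wpM2l => //; apply: ltW.
  split=> //; last lra.
    by rewrite le_min h1 (ltW H_gt0) ge_min lexx orbT.
  by rewrite le_min h2 A_ge0 ge_min lexx orbT.
have opt o' (So' : S o') := let: And5 c1 c2 c3 _ _ := clip o' So' in
  greedy_optimal a_ge0 b_gt0 Y_gt0 gr c1 c2 c3.
have Mo : maximizers S U o.
  by split=> // o' So'; rewrite Uo UE; case: (opt o' So').
have UM o' : maximizers S U o' -> S o' /\ U o' = U o.
  by case=> So' m; split=> //; apply/eqP; rewrite eq_le (Mo.2 _ So') m.
have Co : maximizers (maximizers S U) (fun o => - cost o) o.
  split=> // o' /UM[So' e]; rewrite lerN2 !costE.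
  have [_ []] := opt _ So'; first by rewrite -UE e.
  by have [_ _ _ ? ?] := clip _ So'; lra.
rewrite /selected_replies; case: eqP => [a0|/eqP a_neq0].
  split=> //=; move: g3; rewrite a0 (ltW b_gt0) => -[[]//|[]].
  by rewrite mul0r => Y0; move: Y_gt0; rewrite -Y0 ltxx.
split=> // o' [Mo' co']; have [So' e] := UM _ Mo'.
have : cost o = cost o'.
  by apply/eqP; rewrite eq_le -lerN2 (Co.2 _ Mo') -lerN2 (co' _ Mo).
rewrite !costE => ec; have [_ []] := opt _ So'; first by rewrite -UE e.
have [_ _ _ ? ?] := clip _ So' => ? h.
have <- : Num.min (home o') H = home o' by apply: (mulfI a_neq0); lra.
by apply: h; lra.
Qed.

(** Two selected replies have the same expenditure and the same home order, hence
    the same foreign order because b > 0; so the greedy bundle is the only one. *)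
Lemma selectedP o :
  0 <= a -> 0 < b -> 0 < H -> 0 <= A -> 0 < Y ->
  selected_replies S U cost home a H o <-> greedy a b H A Y (home o) (away o).
Proof.
move=> a_ge0 b_gt0 H_gt0 A_ge0 Y_gt0.
split; last exact: greedy_selected.
have [x [y gxy]] : exists x y, greedy a b H A Y x y.
  have [ab|ba] := le_or_lt a b; last exact: greedy_away_first.
  by have [x /(_ _ A_ge0)[y g]] := greedy_home_first a_ge0 b_gt0 H_gt0 Y_gt0 ab; exists x, y.
have [t xE yE] := pair_surj x y; rewrite -xE -yE in gxy.
have s1 := greedy_selected a_ge0 b_gt0 H_gt0 A_ge0 Y_gt0 gxy; move=> s.
suff [-> ->] : home o = home t /\ away o = away t by [].
have eh : home o = home t.
  move: s1 s; rewrite /selected_replies; case: eqP => _ [c1 h1] [c h]; first by rewrite h1 h.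
  by apply/eqP; rewrite eq_le h1 // h.
split=> //.
have ch o' : selected_replies S U cost home a H o' ->
   maximizers (maximizers S U) (fun o => - cost o) o'.
  by rewrite /selected_replies; case: eqP => _ [].
have [m1 c1] := ch _ s1; have [m c] := ch _ s.
have : cost o = cost t by apply/eqP; rewrite eq_le -lerN2 (c _ m1) -lerN2 (c1 _ m).
rewrite !costE eh => e; apply: (mulfI (lt0r_neq0 b_gt0)); lra.
Qed.

End selected.

(** * Nash equilibria *)

Section nash.
Variable R : realType.
Variables q1 q2 Y1 Y2 rho : R.

Lemma best_reply1P (p r o : plane R) :
  0 < q1 -> 0 < Y1 -> 0 < rho -> nonneg_prices p ->
  best_reply1 q1 q2 Y1 rho p r o <->
  greedy p.1 (p.2 + rho) q1 (Num.max 0 (q2 - r.2)) Y1 o.1 o.2.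
Proof.
move=> ? ? ? [p10 p20]; apply: (@selectedP R fst snd) => //.
- by move=> x y; exists (x, y).
- exact: ltr_wpDl.
- by rewrite le_max lexx.
Qed.

Lemma best_reply2P (p r o : plane R) :
  0 < q2 -> 0 < Y2 -> 0 < rho -> nonneg_prices p ->
  best_reply2 q1 q2 Y2 rho p r o <->
  greedy p.2 (p.1 + rho) q2 (Num.max 0 (q1 - r.1)) Y2 o.2 o.1.
Proof.
move=> ? ? ? [p10 p20]; apply: (@selectedP R snd fst) => //.
- by move=> o'; rewrite /cost2 addrC.
- by move=> o'; split=> -[].
- by move=> x y; exists (y, x).
- exact: ltr_wpDl.
- by rewrite le_max lexx.
Qed.

(** As rho > 0, at least one consumer buys at home first, so that this home order
    does not depend on the other consumer and the replies can be computed one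
    after the other. *)
Lemma nash_exists p :
  0 < q1 -> 0 < q2 -> 0 < Y1 -> 0 < Y2 -> 0 < rho ->
  nonneg_prices p -> exists s, nash q1 q2 Y1 Y2 rho p s.
Proof.
move=> q1_gt0 q2_gt0 Y1_gt0 Y2_gt0 rho_gt0 Dp.
have p1_ge0 : 0 <= (p.1 : R) by case: Dp.
have p2_ge0 : 0 <= (p.2 : R) by case: Dp.
have p1'_gt0 : 0 < (p.1 : R) + rho by lra.
have p2'_gt0 : 0 < (p.2 : R) + rho by lra.
have m0 (z : R) : 0 <= Num.max 0 z by rewrite le_max lexx.
have [le1|gt1] := le_or_lt p.1 (p.2 + rho); last first.
  have [|y2 g2] := greedy_home_first p2_ge0 p1'_gt0 q2_gt0 Y2_gt0; first by lra.
  have [x1 [y1 g1]] := greedy_away_first p2'_gt0 q1_gt0 Y1_gt0 (m0 (q2 - y2)) gt1.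
  have [x2 {}g2] := g2 _ (m0 (q1 - x1)).
  exists ((x1, y1), (x2, y2)).
  by split; [apply/best_reply1P|apply/best_reply2P].
have [|x1 g1] := greedy_home_first p1_ge0 p2'_gt0 q1_gt0 Y1_gt0; first by [].
have [le2|gt2] := le_or_lt p.2 (p.1 + rho); last first.
  have [y2 [x2 g2]] := greedy_away_first p1'_gt0 q2_gt0 Y2_gt0 (m0 (q1 - x1)) gt2.
  have [y1 {}g1] := g1 _ (m0 (q2 - y2)).
  exists ((x1, y1), (x2, y2)).
  by split; [apply/best_reply1P|apply/best_reply2P].
have [|y2 g2] := greedy_home_first p2_ge0 p1'_gt0 q2_gt0 Y2_gt0; first by lra.
have [x2 {}g2] := g2 _ (m0 (q1 - x1)).
have [y1 {}g1] := g1 _ (m0 (q2 - y2)).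
exists ((x1, y1), (x2, y2)).
by split; [apply/best_reply1P|apply/best_reply2P].
Qed.

End nash.

(** * Imports and the trade balance *)

Section shortfall.
Variable R : realType.
Implicit Types q Y p x y : R.

(** At price p the local consumer can pay for Y / p units out of q.  The maximum
    makes the formula 0 when everything is affordable, also for p = 0, and makes
    it a continuous function of p. *)
Definition shortfall q Y p : R := q - Y / Num.max p (Y / q).

Lemma shortfall_eq0 q Y p : 0 < q -> 0 < Y -> p * q <= Y -> shortfall q Y p = 0.
Proof.
move=> q0 Y0 h; rewrite /shortfall max_r ?ler_pdivlMr //.
by rewrite invf_div mulrCA divff ?mulr1 ?subrr // gt_eqF.
Qed.

Lemma shortfall_value q Y p : 0 < q -> 0 < Y -> Y <= p * q ->
  p * shortfall q Y p = p * q - Y.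
Proof.
move=> q0 Y0 h; rewrite /shortfall max_l ?ler_pdivrMr //.
have : p != 0 by apply/eqP => p0; move: h; rewrite p0; lra.
by move=> ?; field.
Qed.

Lemma shortfall_homo q Y : 0 < q -> 0 < Y -> {homo shortfall q Y : x y / x <= y}.
Proof.
move=> q0 Y0 x y xy; rewrite /shortfall lerD2l lerN2 ler_pM2l //.
have Yq : 0 < Y / q by apply: divr_gt0.
have pos (z : R) : 0 < Num.max z (Y / q) by rewrite lt_max Yq orbT.
by rewrite lef_pV2 ?posrE // ge_max !le_max xy lexx /= orbT.
Qed.

Lemma shortfall_ge0 q Y p : 0 < q -> 0 < Y -> 0 <= shortfall q Y p.
Proof.
move=> q0 Y0; have [h|h] := le_or_lt (p * q) Y; first by rewrite shortfall_eq0.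
rewrite -(@shortfall_eq0 q Y (Y / q)) //; last by rewrite divfK // gt_eqF.
by apply: shortfall_homo; rewrite // ler_pdivrMr // ltW.
Qed.

Lemma continuous_shortfall q Y : 0 < q -> 0 < Y -> continuous (shortfall q Y).
Proof.
move=> q0 Y0 x; apply: (@cvgB R R^o); first exact: cvg_cst.
apply: cvgM; first exact: cvg_cst.
apply: cvgV; first by rewrite gt_eqF // lt_max divr_gt0 ?orbT.
by apply: (@continuous_max R R^o idfun (cst (Y / q)) x);
  [exact: cvg_id|exact: cst_continuous].
Qed.

Definition surplus rho q Y p : R := Y - p * q - rho * shortfall q Y p.

Lemma surplus_gap rho q Y x y : 0 < q -> 0 < Y -> 0 < rho -> x <= y ->
  q * (y - x) <= surplus rho q Y x - surplus rho q Y y.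
Proof.
move=> q0 Y0 r0 xy; have := shortfall_homo q0 Y0 xy.
by rewrite -(ler_pM2l r0) /surplus; lra.
Qed.

Lemma continuous_surplus rho q Y : 0 < q -> 0 < Y -> continuous (surplus rho q Y).
Proof.
move=> q0 Y0 x; apply: (@cvgB R R^o); last first.
  by apply: cvgM; [exact: cvg_cst|exact: continuous_shortfall].
apply: (@cvgB R R^o); first exact: cvg_cst.
by apply: cvgM; [exact: cvg_id|exact: cvg_cst].
Qed.

End shortfall.

Section trade.
Variable R : realType.
Variables q1 q2 Y1 Y2 rho p1 p2 al be ga de : R.

(** If consumer I imports, then either I has bought up region I, or region II is so
    much cheaper that consumer II buys at home first.  Either way II takes home
    goods before importing any, and leaves exactly the shortfall of region II. *)
Lemma nash_imports : 0 < q1 -> 0 < q2 -> 0 < Y1 -> 0 < Y2 -> 0 < rho ->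
  0 <= p1 -> 0 <= p2 ->
  greedy p1 (p2 + rho) q1 (Num.max 0 (q2 - de)) Y1 al be ->
  greedy p2 (p1 + rho) q2 (Num.max 0 (q1 - al)) Y2 de ga ->
  [/\ 0 <= be, be <= shortfall q2 Y2 p2 &
      p1 * q1 <= Y1 -> be = shortfall q2 Y2 p2 \/ Y1 - p1 * q1 <= (p2 + rho) * be].
Proof.
move=> q1_gt0 q2_gt0 Y1_gt0 Y2_gt0 rho_gt0 p1_ge0 p2_ge0.
move=> [/andP[al0 alq] /andP[be0 beA] bud1 g1] [/andP[de0 deq] /andP[ga0 gaB] bud2 g2].
rewrite max_r in beA g1; last lra.
rewrite max_r in gaB g2; last lra.
(* A home-first consumer II, or one who finds region I sold out, leaves exactly
   the shortfall of region II. *)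
have shf : al = q1 \/ p2 <= p1 + rho -> q2 - de = shortfall q2 Y2 p2.
  move=> c; have : de = q2 \/ p2 * de = Y2.
    have [h|h] := le_or_lt p2 (p1 + rho).
      by move: g2; rewrite h => -[[-> _]|[-> _]]; [left|right].
    case: c => c; last by lra.
    have ga_eq0 : ga = 0 by lra.
    move: g2; rewrite (leNgt p2) h ga_eq0 /= !mulr0 addr0.
    by case=> [[_ []]|[]]; [left|right|lra].
  have ga_cost : 0 <= (p1 + rho) * ga by apply: mulr_ge0; lra.
  case=> deE.
    by rewrite deE subrr shortfall_eq0 //; rewrite deE in bud2; lra.
  have p2_neq0 : p2 != 0 by apply/eqP => p20; move: deE; rewrite p20; lra.
  apply: (mulfI p2_neq0); rewrite shortfall_value //; first lra.
  by rewrite -deE; apply: ler_wpM2l.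
have [h|h] := le_or_lt p1 (p2 + rho); [rewrite h in g1|rewrite (leNgt p1) h /= in g1].
  case: g1 => [[alE beE]|[alE beE]].
    rewrite alE in beE; split=> //; first by rewrite -shf; [|left].
    by case: beE => beE _; [left; rewrite beE shf //; left|right; lra].
  split=> //; first by rewrite beE; exact: shortfall_ge0.
  move=> _; right; rewrite beE mulr0 subr_le0 -alE.
  exact: ler_wpM2l.
rewrite shf in beA g1; last by right; lra.
split=> // _; case: g1 => [[-> _]|[beE _]]; [by left|right].
by have := mulr_ge0 p1_ge0 (ltW q1_gt0); lra.
Qed.

End trade.

Section balance.
Variable R : realType.

(** The case where only consumer I can import: region I has shortfall 0.  If the
    whole shortfall k2 is imported, as is the case when e >= 0, then V1 + V2 = e.
    Otherwise I spends at least Y1 - p1 q1 on imports, of which only the share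
    p2 / (p2 + rho) reaches region II.  The hypothesis on c says that this share
    is at least c at all prices p2 >= Y2 / q2. *)
Lemma one_way_balance (c q1 q2 Y1 Y2 rho p1 p2 be k2 : R) :
  let V1 := Y1 - p1 * q1 - (p2 + rho) * be in
  let V2 := Y2 - p2 * q2 + p2 * be in
  let e := Y1 - p1 * q1 - rho * 0 + (Y2 - p2 * q2 - rho * k2) in
  0 < q2 -> 0 < Y2 -> 0 < rho -> 0 <= p2 ->
  0 < c -> c * (Y2 + rho * q2) <= Y2 -> p1 * q1 <= Y1 -> Y2 <= p2 * q2 ->
  p2 * k2 = p2 * q2 - Y2 -> 0 <= be <= k2 ->
  be = k2 \/ Y1 - p1 * q1 <= (p2 + rho) * be ->
  (0 <= e -> [/\ 0 <= V1, 0 <= V2 & V1 + V2 = e]) /\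
  (e <= 0 -> [/\ V1 <= 0, V2 <= 0 & e <= V1 + V2 <= c * e]).
Proof.
move=> V1 V2 e q2_gt0 Y2_gt0 rho_gt0 p2_ge0 c_gt0 hc h1 h2 k2E /andP[be0 bek] alt.
have p2'_gt0 : 0 < p2 + rho by lra.
have eE : e = Y1 - p1 * q1 - (p2 + rho) * k2 by rewrite /e; lra.
have p2be : p2 * be <= p2 * k2 by apply: ler_wpM2l.
have rbe : rho * be <= rho * k2 by apply: ler_wpM2l => //; exact: ltW.
rewrite /V1 /V2; clearbody e; split=> e0.
  have -> : be = k2.
    case: alt => // alt; apply/eqP; rewrite eq_le bek -(ler_pM2l p2'_gt0); lra.
  by split; lra.
have c_rho : c * (p2 + rho) <= p2.
  have crq : 0 <= c * (rho * q2) by rewrite !mulr_ge0 // ltW.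
  have c_le1 : c <= 1 by rewrite -(ler_pM2r Y2_gt0); lra.
  have s1 : 0 <= (1 - c) * (p2 * q2 - Y2) by apply: mulr_ge0; lra.
  by rewrite -(ler_pM2r q2_gt0); lra.
have hce : 0 <= (p2 - c * (p2 + rho)) * - e by apply: mulr_ge0; lra.
have V1_le0 : Y1 - p1 * q1 - (p2 + rho) * be <= 0 by case: alt => [->|]; lra.
have V2_le0 : Y2 - p2 * q2 + p2 * be <= 0 by lra.
split=> //; apply/andP; split; first by lra.
rewrite -(ler_pM2l p2'_gt0).
set s := (X in _ * X <= _).
suff : (p2 + rho) * s <= p2 * e by lra.
rewrite /s; case: alt => [->|alt].
  have : 0 <= rho * - e by apply: mulr_ge0; lra.
  have E0 : Y2 = p2 * q2 - p2 * k2 by lra.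
  by rewrite E0 eE; lra.
have : 0 <= rho * ((p2 + rho) * be - (Y1 - p1 * q1)) by apply: mulr_ge0; lra.
have E0 : Y2 = p2 * q2 - p2 * k2 by lra.
by rewrite E0 eE; lra.
Qed.

(** V1 and V2 are the velocities multiplied by q1 and q2.  If both prices are too
    high, the excess differs from Y1 - p1 q1 + Y2 - p2 q2 by the cost of
    transporting the shortfalls, and each shortfall is at most q (p q - Y) / Y;
    this is what c has to absorb then. *)
Lemma trade_balance (c q1 q2 Y1 Y2 rho p1 p2 be ga : R) :
  let k1 := shortfall q1 Y1 p1 in let k2 := shortfall q2 Y2 p2 in
  let V1 := Y1 - p1 * q1 + p1 * ga - (p2 + rho) * be in
  let V2 := Y2 - p2 * q2 + p2 * be - (p1 + rho) * ga in
  let e := surplus rho q1 Y1 p1 + surplus rho q2 Y2 p2 in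
  0 < q1 -> 0 < q2 -> 0 < Y1 -> 0 < Y2 -> 0 < rho -> 0 <= p1 -> 0 <= p2 ->
  0 < c -> c * (Y1 + rho * q1) <= Y1 -> c * (Y2 + rho * q2) <= Y2 ->
  0 <= be <= k2 -> 0 <= ga <= k1 ->
  (p1 * q1 <= Y1 -> be = k2 \/ Y1 - p1 * q1 <= (p2 + rho) * be) ->
  (p2 * q2 <= Y2 -> ga = k1 \/ Y2 - p2 * q2 <= (p1 + rho) * ga) ->
  (0 <= e -> [/\ 0 <= V1, 0 <= V2 & V1 + V2 = e]) /\
  (e <= 0 -> [/\ V1 <= 0, V2 <= 0 & e <= V1 + V2 <= c * e]).
Proof.
move=> k1 k2 V1 V2 e q1_gt0 q2_gt0 Y1_gt0 Y2_gt0 rho_gt0 p1_ge0 p2_ge0.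
move=> c_gt0 hc1 hc2 hbe hga alt1 alt2.
have e_def : e = Y1 - p1 * q1 - rho * k1 + (Y2 - p2 * q2 - rho * k2) by [].
have [h1|h1] := le_or_lt (p1 * q1) Y1; have [h2|h2] := le_or_lt (p2 * q2) Y2.
- have k10 : k1 = 0 by exact: shortfall_eq0.
  have k20 : k2 = 0 by exact: shortfall_eq0.
  rewrite /V1 /V2 e_def.
  move: hbe hga; rewrite k10 k20 => /andP[b0 b1] /andP[g0 g1].
  have -> : be = 0 by lra.
  have -> : ga = 0 by lra.
  split=> e0; first by split; lra.
  have -> : Y1 = p1 * q1 by lra.
  have -> : Y2 = p2 * q2 by lra.
  by split; lra.
- have k10 : k1 = 0 by exact: shortfall_eq0.
  have ga0 : ga = 0 by move: hga; rewrite k10 => /andP[g0 g1]; lra.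
  have := one_way_balance q2_gt0 Y2_gt0 rho_gt0 p2_ge0 c_gt0 hc2 h1 (ltW h2)
    (shortfall_value q2_gt0 Y2_gt0 (ltW h2)) hbe (alt1 h1).
  by rewrite e_def /V1 /V2 ga0 k10 !mulr0 addr0 !subr0.
- have k20 : k2 = 0 by exact: shortfall_eq0.
  have be0 : be = 0 by move: hbe; rewrite k20 => /andP[b0 b1]; lra.
  have := one_way_balance q1_gt0 Y1_gt0 rho_gt0 p1_ge0 c_gt0 hc1 h2 (ltW h1)
    (shortfall_value q1_gt0 Y1_gt0 (ltW h1)) hga (alt2 h2).
  rewrite e_def /V1 /V2 be0 k20 !mulr0 addr0 !subr0.
  rewrite [_ + (_ - rho * _)]addrC [X in _ <= X <= _]addrC [X in X = _]addrC.
  by case=> H1 H2; split=> [/H1|/H2] [].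
- have E1 : p1 * k1 = p1 * q1 - Y1 by apply: shortfall_value => //; exact: ltW.
  have E2 : p2 * k2 = p2 * q2 - Y2 by apply: shortfall_value => //; exact: ltW.
  have /andP[be0 bek] := hbe; have /andP[ga0 gak] := hga.
  have rk1 : rho * ga <= rho * k1 by rewrite ler_pM2l.
  have rk2 : rho * be <= rho * k2 by rewrite ler_pM2l.
  have pk1 : p1 * ga <= p1 * k1 by apply: ler_wpM2l.
  have pk2 : p2 * be <= p2 * k2 by apply: ler_wpM2l.
  have rga : 0 <= rho * ga by apply: mulr_ge0 => //; exact: ltW.
  have rbe : 0 <= rho * be by apply: mulr_ge0 => //; exact: ltW.
  have pbe : 0 <= p2 * be by apply: mulr_ge0.
  have pga : 0 <= p1 * ga by apply: mulr_ge0.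
  split=> e0; first by exfalso; rewrite e_def in e0; lra.
  have bound (q Y p k : R) : 0 < q -> 0 < Y -> p * k = p * q - Y -> Y < p * q -> 0 <= k ->
      c * (Y + rho * q) <= Y -> c * (p * q - Y + rho * k) <= p * q - Y.
    move=> q0 Y0 kE h k0 hc; rewrite -(ler_pM2l Y0).
    have s1 : c * rho * (Y * k) <= c * rho * (q * (p * q - Y)).
      apply: ler_wpM2l; first by rewrite mulr_ge0 // ltW.
      rewrite -kE.
      have : 0 <= k * (p * q - Y) by apply: mulr_ge0; lra.
      by lra.
    have : 0 <= (Y - c * (Y + rho * q)) * (p * q - Y) by apply: mulr_ge0; lra.
    by lra.
  have B1 := bound _ _ _ _ q1_gt0 Y1_gt0 E1 h1 (le_trans ga0 gak) hc1.
  have B2 := bound _ _ _ _ q2_gt0 Y2_gt0 E2 h2 (le_trans be0 bek) hc2.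
  by rewrite e_def /V1 /V2; split; lra.
Qed.
End balance.

(** * Absolutely continuous functions with nonpositive derivative *)

Section cousin.
Variable R : realType.

(** Cousin's lemma: a property of intervals that is inherited by unions of adjacent
    intervals, and that holds for all short intervals around each point, holds for
    [a, b]. *)
Lemma cousin_induction (P : R -> R -> Prop) (a b : R) : a <= b ->
  (forall u v w, a <= u -> u <= v -> v <= w -> w <= b -> P u v -> P v w -> P u w) ->
  (forall t, a <= t <= b -> exists2 d, 0 < d &
     forall u v, a <= u -> u <= t -> t <= v -> v <= b -> v - u < d -> P u v) ->
  P a b.
Proof.
move=> ab Padd Ploc; pose S := [set t | a <= t <= b /\ P a t].
have Sa : S a.
  split; first by rewrite lexx.
  have [|d d0] := Ploc a; first by rewrite lexx.
  by apply=> //; rewrite subrr.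
have Sb : ubound S b by move=> t [/andP[]].
have hsS : has_sup S by split; [exists a|exists b].
set c := sup S.
have ac : a <= c by apply: (sup_upper_bound hsS).
have cb : c <= b by apply: ge_sup => //; exists a.
have [|d d0 Pd] := Ploc c; first by rewrite ac cb.
have [|s [/andP[as_ sb] Ps] cs] := @sup_adherent _ S (d / 2) _ hsS; first by lra.
rewrite -/c in cs.
have sc : s <= c by apply: (sup_upper_bound hsS); split=> //; rewrite as_ sb.
(* The minimum v of b and c + d / 4 lies beyond c unless c = b. *)
have mx : exists v, [/\ c <= v, v <= b, v <= c + d / 4 & v < b -> c < v].
  have [h|h] := le_or_lt b (c + d / 4).
    by exists b; split; lra.
  by exists (c + d / 4); split; lra.
have [v [cv vb vd vlt]] := mx.
have Pv : P a v.
  apply: (Padd _ s) => //; first lra.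
  by apply: Pd => //; lra.
have vc : v <= c by apply: (sup_upper_bound hsS); split => //; rewrite vb (le_trans ac).
have [<-//|vb'] := eqVneq v b.
have : v < b by rewrite lt_neqAle vb'.
by move=> /vlt; rewrite ltNge vc.
Qed.

End cousin.

Section monotone.
Variable R : realType.
Notation mu := (@lebesgue_measure R).

(** [absolutely_continuous] for real functions *)
Definition ac_real (a b : R) (y : R -> R) : Prop :=
  forall e : R, 0 < e -> exists2 d : R, 0 < d &
    forall (n : nat) (s t : 'I_n -> R),
      (forall i, [/\ a <= s i, s i <= t i & t i <= b]) ->
      (forall i j, i != j -> t i <= s j \/ t j <= s i) ->
      \sum_(i < n) (t i - s i) < d ->
      \sum_(i < n) `|y (t i) - y (s i)| < e.

(** Lists ordered from left to right can be concatenated, which suits an induction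
    on adjacent intervals. *)
Lemma ac_real_seq a b y e : ac_real a b y -> 0 < e -> exists2 d : R, 0 < d &
  forall l : seq (R * R),
    all (fun i => [&& a <= i.1, i.1 <= i.2 & i.2 <= b]) l ->
    pairwise (fun i j => i.2 <= j.1) l ->
    \sum_(i <- l) (i.2 - i.1) < d -> \sum_(i <- l) `|y i.2 - y i.1| < e.
Proof.
move=> /[apply] -[d d0 acd]; exists d => // l ab pw.
rewrite !(big_nth (0, 0)) !big_mkord; apply: acd.
  move=> i; have /(_ _ (ltn_ord i)) := all_nthP (0, 0) ab.
  by case/and3P.
move/(pairwiseP (0, 0)): pw => pw i j.
rewrite neq_ltn => /orP[ij|ji]; [left|right].
  exact: (pw _ _ (ltn_ord i) (ltn_ord j) ij).
exact: (pw _ _ (ltn_ord j) (ltn_ord i) ji).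
Qed.

(** Intervals around t are needed, not only those with endpoint t. *)
Lemma nonpositive_derive_straddle (y : R -> R) (t l e : R) : 0 < e ->
  is_derive t 1 y l -> l <= 0 -> exists2 d, 0 < d &
  forall u v, u <= t -> t <= v -> v - u < d -> y v - y u <= e * (v - u).
Proof.
move=> e0 [dy dyE] l0.
have : h^-1 *: (y (h *: 1 + t) - y t) @[h --> 0^'] --> l.
  by rewrite -dyE; exact: dy.
move/cvgrPdist_lt => /(_ _ e0); case=> [d /= d0 hd].
exists d => // u v ut tv uvd.
have step h : h != 0 -> `|h| < d -> `|y (h + t) - y t - h * l| <= e * `|h|.
  move=> h0 hh; have := hd h; rewrite /= sub0r normrN => /(_ hh h0).
  rewrite /GRing.scale /= mulr1 => /ltW; rewrite -(ler_pM2r (_ : 0 < `|h|)) ?normr_gt0 //.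
  by rewrite -normrM mulrBl (mulrAC _ _ h) mulVf // mul1r distrC (mulrC l).
have right : y v - y t <= e * (v - t).
  have [->|vt] := eqVneq v t; first by rewrite !subrr mulr0.
  have := step (v - t); rewrite subr_eq0 => /(_ vt).
  have -> : `|v - t| = v - t by rewrite ger0_norm // subr_ge0.
  rewrite subrK => s; have /ler_normlP[_] : `|y v - y t - (v - t) * l| <= e * (v - t) by apply: s; lra.
  have : 0 <= (v - t) * - l by apply: mulr_ge0; lra.
  lra.
have left : y t - y u <= e * (t - u).
  have [->|vt] := eqVneq u t; first by rewrite !subrr mulr0.
  have := step (u - t); rewrite subr_eq0 => /(_ vt).
  have -> : `|u - t| = t - u by rewrite ler0_norm ?opprB // subr_le0.
  rewrite subrK => s; have /ler_normlP[+ _] : `|y u - y t - (u - t) * l| <= e * (t - u) by apply: s; lra.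
  have : 0 <= (t - u) * - l by apply: mulr_ge0; lra.
  lra.
lra.
Qed.

Local Open Scope ereal_scope.
Lemma null_cover (A : set R) (d : R) : (0 < d)%R -> mu.-negligible A ->
  exists U : set R, [/\ open U, A `<=` U & mu U < d%:E].
Proof.
move=> d0 [B [mB B0 AB]].
have [|U [oU BU UB]] := lebesgue_regularity_outer mB _ d0; first by change (mu B < +oo); rewrite B0 ltry.
exists U; split=> //; first exact: subset_trans BU.
have mU : measurable U by exact: measurable_realfun.open_measurable.
rewrite -(setDUK BU) measureU //; last by rewrite setDIK.
  by change (mu B + mu (U `\` B) < d%:E); rewrite B0 add0e.
exact: measurableD.
Qed.

Lemma measure_split (U : set R) (u v w : R) : measurable U -> (u <= v)%R -> (v <= w)%R ->
  mu (U `&` `]u, w]) = mu (U `&` `]u, v]) + mu (U `&` `]v, w]).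
Proof.
move=> mU uv vw; rewrite -measureU.
- rewrite -setIUr -itv_bndbnd_setU //= bnd_simp //.
- exact: measurableI.
- exact: measurableI.
- rewrite setIACA setIid -subset0 => x [_ /=]; rewrite !in_itv /= => -[/andP[_ xv] /andP[vx _]].
  by move: vx; rewrite ltNge xv.
Qed.

Local Open Scope ring_scope.

(** Cover the exceptional null set by an open set U of small measure.  By Cousin's
    lemma, [a, b] splits into intervals on which y grows at rate at most e and
    intervals contained in U; absolute continuity bounds the growth on the
    latter. *)
Lemma ac_nonincreasing (a b : R) (y : R -> R) : a <= b -> ac_real a b y ->
  {ae mu, forall t : R, a < t < b -> exists2 l, l <= 0 & is_derive t 1 y l} ->
  y b <= y a.
Proof.
move=> ab acy /= aey.
apply: contrapT => /negP; rewrite -ltNge => yab.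
pose e := (y b - y a) / (b - a + 1) / 2.
have e0 : 0 < e by rewrite !divr_gt0 //; lra.
have eE : e * (b - a + 1) = (y b - y a) / 2 by rewrite /e; field; lra.
have [d d0 acd] := ac_real_seq acy e0.
have neg : mu.-negligible (~` [set t | a < t < b -> exists2 l, l <= 0 & is_derive t 1 y l]
     `|` [set a] `|` [set b]).
  by do 2 (apply: negligibleU; last by (apply/negligibleP; [exact: measurable_set1|exact: lebesgue_measure_set1])).
have [U [oU NU Ud]] := null_cover d0 neg.
have mU : measurable U by exact: measurable_realfun.open_measurable.
(* P u v: apart from the intervals of some list inside ]u, v], whose total length
   is at most the measure of U in ]u, v], y grows at rate at most e. *)
pose P u v := exists l : seq (R * R),
  [/\ all (fun i => [&& u <= i.1, i.1 <= i.2 & i.2 <= v]) l,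
      pairwise (fun i j => i.2 <= j.1) l,
      ((\sum_(i <- l) (i.2 - i.1))%:E <= mu (U `&` `]u, v]))%E &
      y v - y u <= e * (v - u) + \sum_(i <- l) `|y i.2 - y i.1|].
have [||l [al pl ml yl]] := @cousin_induction R P a b ab.
- move=> u v w au uv vw wb [l1 [a1 p1 m1 y1]] [l2 [a2 p2 m2 y2]].
  exists (l1 ++ l2); split.
  + rewrite all_cat; apply/andP; split.
      by apply: sub_all a1 => i /and3P[-> -> /= /le_trans]; apply.
    by apply: sub_all a2 => i /and3P[/(le_trans uv) -> -> ->].
  + rewrite pairwise_cat p1 p2 !andbT.
    apply/allrelP => i j /(allP a1)/and3P[_ _ iv] /(allP a2)/and3P[vj _ _].
    exact: le_trans vj.
  + by rewrite big_cat /= (measure_split mU uv vw) EFinD leeD.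
  + by rewrite big_cat /=; lra.
- move=> t /andP[at_ tb]; have [Ut|nUt] := pselect (U t).
    have /nbhs_ballP[r /= r0 rU] : nbhs t U by exact: open_nbhs_nbhs.
    exists r => // u v au ut tv vb uvr; exists [:: (u, v)]; split=> //=.
    + by rewrite !lexx (le_trans ut tv).
    + rewrite big_seq1 /= setIidr; last first.
        move=> x /=; rewrite in_itv /= => /andP[ux xv]; apply: rU.
        by rewrite -ball_normE /= ltr_norml; apply/andP; split; lra.
      rewrite lebesgue_measure_itv /= lte_fin; case: ltP => uv //.
      by rewrite lee_fin subr_le0.
    + rewrite big_seq1 /=; have : 0 <= e * (v - u) by apply: mulr_ge0; lra.
      by have := ler_norm (y v - y u); lra.
  have [z z_le0 dz] : exists2 l, l <= 0 & is_derive t 1 y l.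
    apply: contrapT => nd; apply: nUt; apply: NU.
    have [ta|ta] := eqVneq t a; first by left; right.
    have [tb'|tb'] := eqVneq t b; first by right.
    left; left => /= h; apply: nd; apply: h.
    by rewrite !lt_neqAle at_ tb eq_sym ta tb'.
  have [r r0 hr] := nonpositive_derive_straddle e0 dz z_le0.
  exists r => // u v au ut tv vb uvr; exists [::]; split=> //=.
    by rewrite big_nil.
  by rewrite big_nil addr0; exact: hr.
have : \sum_(i <- l) (i.2 - i.1) < d.
  rewrite -lte_fin; apply: le_lt_trans Ud; apply: le_trans ml _.
  by apply: le_measure; rewrite ?inE //; exact: measurableI.
by move=> /(acd _ al pl); lra.
Qed.

End monotone.

(** * Filippov's convexification *)

Section plane.
Variable R : realType.
Implicit Types (p v : plane R).

Definition lin (a b : R) v : R := a * v.1 + b * v.2.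

Lemma plane_norm_lt v d : `|v| < d = (`|v.1| < d) && (`|v.2| < d).
Proof. by rewrite prod_normE /= gt_max. Qed.

Lemma continuous_lin a b : continuous (lin a b : plane R -> R^o).
Proof.
move=> p; apply: (@cvgD R R^o).
  by apply: cvgM; [exact: cvg_cst|exact: cvg_fst].
by apply: cvgM; [exact: cvg_cst|exact: cvg_snd].
Qed.

Lemma closed_convex_halfplane a b k :
  closed [set v | k <= lin a b v] /\ convex_set [set v | k <= lin a b v].
Proof.
split.
  rewrite (_ : [set v | _] = (lin a b : plane R -> R^o) @^-1` [set x | k <= x]) //.
  by apply: preimage_closed; [move=> ? _; exact: continuous_lin|exact: closed_ge].
apply/convex_setW => u v; rewrite !inE /= => hu hv l l0 l1.
rewrite /conv /= inE /lin /=.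
have step (x1 x2 y1 y2 w : R) : 0 < w -> w < 1 -> k <= a * x1 + b * x2 -> k <= a * y1 + b * y2 ->
    k <= a * (w * x1 + (1 - w) * y1) + b * (w * x2 + (1 - w) * y2).
  move=> w0 w1 hx hy.
  have : 0 <= w * (a * x1 + b * x2 - k) by apply: mulr_ge0; lra.
  have : 0 <= (1 - w) * (a * y1 + b * y2 - k) by apply: mulr_ge0; lra.
  by lra.
exact: step.
Qed.

Section convexification.
Variables (D : set (plane R)) (f : plane R -> plane R).

(** A bound that the field satisfies near p passes to its convexification at p. *)
Lemma filippov_halfplane a b k d p v : 0 < d ->
  (forall q, `|q - p| < d -> D q -> k <= lin a b (f q)) ->
  filippov D f p v -> k <= lin a b v.
Proof.
move=> d0 hf /(_ d set0 d0 (negligible_set0 _)) hv.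
apply: (hv [set w | k <= lin a b w]); split; first by have [] := closed_convex_halfplane a b k.
move=> w [q [[pq Dq] _] <-] /=; apply: hf => //.
by move: pq; rewrite -ball_normE /= distrC.
Qed.

Lemma quadrant_not_negligible p (d : R) : 0 < d ->
  ~ plane_negligible [set q : plane R | p.1 < q.1 < p.1 + d /\ p.2 < q.2 < p.2 + d].
Proof.
move=> d0; rewrite /plane_negligible.
rewrite (_ : [set q | _] = `]p.1 : R, (p.1 : R) + d[%classic `*` `](p.2 : R), (p.2 : R) + d[%classic); last first.
  by apply/seteqP; split=> q /=; rewrite !in_itv.
move/negligibleP => h; have := h (measurableX (measurable_itv _) (measurable_itv _)).
rewrite /= product_measure1E //= !lebesgue_measure_itv /= !lte_fin !ltrDl d0.
rewrite -!EFinB -EFinM => /eqP; rewrite eqe.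
by rewrite !(addrC _ d) !addrK mulf_eq0 gt_eqF.
Qed.

(** Null sets cannot hide the values near 0, because D contains a small quadrant
    with corner p, even if p is on the boundary of D. *)
Lemma filippov_zero p : (forall q, D q <-> nonneg_prices q) -> D p ->
  (forall e, 0 < e -> exists2 d, 0 < d &
    forall q, `|q - p| < d -> D q -> `|f q| < e) ->
  filippov D f p 0.
Proof.
move=> DE Dp fc d N d0 negN C [[clC _] subC].
apply: clC => B /nbhs_ballP[e /= e0 eB].
have [r r0 hr] := fc _ e0.
have rd0 : 0 < Num.min r d by rewrite lt_min r0 d0.
have [q [/andP[p1q qp1] /andP[p2q qp2]] nNq] : exists2 q : plane R,
    p.1 < q.1 < p.1 + Num.min r d /\ p.2 < q.2 < p.2 + Num.min r d & ~ N q.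
  apply: contrapT => h; apply: (@quadrant_not_negligible p _ rd0).
  apply: negligibleS negN => q hq; apply: contrapT => nNq; apply: h.
  by exists q.
have [p1_ge0 p2_ge0] : nonneg_prices p by exact/DE.
have Dq : D q by apply/DE; split; [exact: le_trans (ltW p1q)|exact: le_trans (ltW p2q)].
have qp : `|q - p| < Num.min r d.
  rewrite plane_norm_lt /= !gtr0_norm ?subr_gt0 //.
  by rewrite !ltrBlDl qp1 qp2.
have [qr qd] : `|q - p| < r /\ `|q - p| < d by move: qp; rewrite lt_min => /andP.
exists (f q); split.
  by apply: subC; exists q => //; split=> //; split=> //; rewrite -ball_normE /= distrC.
by apply: eB; rewrite -ball_normE /= sub0r normrN; exact: hr.
Qed.

End convexification.
End plane.

(** * Monotone trajectories *)

Section trajectories.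
Variable R : realType.
Variables (D : set (plane R)) (f : plane R -> plane R).
Implicit Types (p v : plane R) (x : R -> plane R) (T : R).

Lemma linB a b p v : lin a b (p - v) = lin a b p - lin a b v.
Proof.
have E (p1 p2 v1 v2 : R) :
  a * (p1 - v1) + b * (p2 - v2) = a * p1 + b * p2 - (a * v1 + b * v2) by ring.
exact: E.
Qed.

Lemma linZ a b k v : lin a b (k *: v) = k * lin a b v.
Proof.
have E (v1 v2 : R) : a * (k * v1) + b * (k * v2) = k * (a * v1 + b * v2) by ring.
exact: E.
Qed.

Lemma lin_norm a b v : `|a| + `|b| <= 1 -> `|lin a b v| <= `|v|.
Proof.
move=> ab; rewrite prod_normE /=.
apply: (le_trans (ler_normD _ _)); rewrite !normrM.
set m := Num.max _ _.
have h1 : `|a| * `|v.1| <= `|a| * m by rewrite ler_wpM2l // le_max lexx.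
have h2 : `|b| * `|v.2| <= `|b| * m by rewrite ler_wpM2l // le_max lexx orbT.
apply: (le_trans (lerD h1 h2)); rewrite -mulrDl ler_piMl //.
by rewrite le_max normr_ge0.
Qed.

Lemma is_derive_lin a b x (t : R) v :
  is_derive (t : R^o) (1 : R^o) x v -> is_derive t 1 (lin a b \o x : R -> R) (lin a b v).
Proof.
move=> [dx dxE].
have cx : (fun h : R^o => h^-1 *: ((x \o shift (t : R^o)) (h *: (1 : R^o)) - x t)) @ 0^' --> v.
  by rewrite -dxE; exact: dx.
have cl : (fun h : R => h^-1 *: (((lin a b \o x) \o shift t) (h *: 1) - (lin a b \o x) t)) @ 0^'
    --> lin a b v.
  rewrite (_ : (fun h : R => _) = (lin a b : plane R -> R^o) \o
    (fun h : R^o => h^-1 *: ((x \o shift (t : R^o)) (h *: (1 : R^o)) - x t))).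
    by apply: (cvg_comp _ _ cx); exact: continuous_lin.
  by apply/funext => h /=; rewrite linZ linB.
split; first by apply/cvg_ex; exists (lin a b v).
exact: (cvg_lim (@Rhausdorff R) cl).
Qed.

Lemma ac_lin a b T x s t : `|a| + `|b| <= 1 -> 0 <= s -> t <= T ->
  absolutely_continuous 0 T x -> ac_real s t (lin a b \o x).
Proof.
move=> ab s0 tT acx e e0; have [d d0 h] := acx e e0.
exists d => // n u w huw dj sd.
apply: le_lt_trans (h n u w _ dj sd).
  by apply: ler_sum => i _ /=; rewrite -linB lin_norm.
move=> i; have [su uw wt] := huw i.
by split=> //; [exact: le_trans su|exact: le_trans tT].
Qed.

Lemma solution_nonincreasing a b T x s t : `|a| + `|b| <= 1 ->
  solution_upto D f T x -> 0 <= s -> s <= t -> t <= T ->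
  (forall u, s < u < t -> D (x u) -> forall v, filippov D f (x u) v -> lin a b v <= 0) ->
  lin a b (x t) <= lin a b (x s).
Proof.
move=> ab [acx Dx aex] s0 st tT hv.
apply: (@ac_nonincreasing R s t (lin a b \o x) st (ac_lin ab s0 tT acx)).
apply: negligibleS aex => u /= nder hu; apply: nder => /andP[su ut].
have u0 : 0 < u by exact: le_lt_trans su.
have uT : u < T by exact: lt_le_trans tT.
have [|v fv dv] := hu; first by rewrite u0 uT.
exists (lin a b v); last exact: is_derive_lin.
apply: (hv u _ _ v fv); first by rewrite su ut.
by apply: Dx; rewrite !ltW.
Qed.

Lemma ac_continuous T x : absolutely_continuous 0 T x -> forall e, 0 < e ->
  exists2 d, 0 < d & forall s t, 0 <= s <= T -> 0 <= t <= T -> `|t - s| < d ->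
    `|x t - x s| < e.
Proof.
move=> acx e e0; have [d d0 h] := acx e e0; exists d => //.
have main s t : 0 <= s -> s <= t -> t <= T -> t - s < d -> `|x t - x s| < e.
  move=> s0 st tT std; have := h 1%N (fun=> s) (fun=> t).
  by rewrite !big_ord1; apply=> // i j; rewrite !ord1.
move=> s t /andP[s0 sT] /andP[t0 tT] std; have [st|st] := leP s t.
  by apply: main => //; rewrite ger0_norm ?subr_ge0 in std.
rewrite distrC; apply: main => //; first exact: ltW.
by rewrite ltr0_norm ?subr_lt0 // opprB in std.
Qed.

(** The argument uses only the following features of the excess e; below, g is a
    sign. *)
Section signed.
Variables (e : plane R -> R) (q1 q2 : R).
Hypotheses (q1_gt0 : 0 < q1) (q2_gt0 : 0 < q2).
Hypothesis e_cont : forall p h, 0 < h -> exists2 d, 0 < d &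
  forall q, `|q - p| < d -> `|e q - e p| < h.
Hypothesis e_gap : forall p v, p.1 <= v.1 -> p.2 <= v.2 ->
  q1 * (v.1 - p.1) + q2 * (v.2 - p.2) <= e p - e v.
Hypothesis vel_sign : forall g p v, g = 1 \/ g = -1 -> D p -> filippov D f p v ->
  0 <= g * e p -> 0 <= g * v.1 /\ 0 <= g * v.2.

(** While g * e stays nonnegative, both prices move in the direction of g. *)
Lemma sign_order g x T s t : g = 1 \/ g = -1 -> solution_upto D f T x ->
  0 <= s -> s <= t -> t <= T ->
  (forall u, s < u < t -> 0 <= g * e (x u)) ->
  g * (x s).1 <= g * (x t).1 /\ g * (x s).2 <= g * (x t).2.
Proof.
move=> gE sol s0 st tT pos.
have g1 : `|- g| = 1 by case: gE => ->; rewrite ?opprK ?normrN normr1.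
have mono a b : `|a| + `|b| <= 1 ->
    (forall v, 0 <= g * v.1 -> 0 <= g * v.2 -> lin a b v <= 0) ->
    lin a b (x t) <= lin a b (x s).
  move=> ab hab; apply: (solution_nonincreasing ab sol s0 st tT) => u su Du v fv.
  by have [h1 h2] := vel_sign gE Du fv (pos u su); exact: hab.
split; rewrite -lerN2 -!mulNr.
- have := mono (- g) 0; rewrite normr0 addr0 g1 lexx /lin !mul0r !addr0; apply=> // v.
  by rewrite mul0r addr0 mulNr oppr_le0.
- have := mono 0 (- g); rewrite normr0 add0r g1 lexx /lin !mul0r !add0r; apply=> // v.
  by rewrite mul0r add0r mulNr oppr_le0.
Qed.

Lemma excess_order g p v : g = 1 \/ g = -1 ->
  g * p.1 <= g * v.1 -> g * p.2 <= g * v.2 ->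
  `|v.1 - p.1| * q1 + `|v.2 - p.2| * q2 <= g * e p - g * e v.
Proof.
case=> ->; first rewrite !mul1r.
  move=> h1 h2; rewrite !ger0_norm ?subr_ge0 // -!(mulrC q1) -!(mulrC q2).
  exact: e_gap.
rewrite !mulN1r !lerN2 => h1 h2; rewrite !ler0_norm ?subr_le0 // !opprB addrC opprK.
by rewrite addrC (mulrC _ q1) (mulrC _ q2) [leRHS]addrC e_gap.
Qed.

(** Let c be the last time before t at which g * e is nonnegative.  If c < t, then
    between c and t the prices move in the direction - g, which makes g * e grow;
    so it is still nonnegative at t. *)
Lemma sign_invariant g x T t : g = 1 \/ g = -1 -> solution_upto D f T x ->
  0 <= g * e (x 0) -> 0 <= t <= T -> 0 <= g * e (x t).
Proof.
move=> gE sol e0 /andP[t0 tT]; have [acx Dx _] := sol.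
rewrite leNgt; apply/negP => et.
pose S := [set u | 0 <= u <= t /\ 0 <= g * e (x u)].
have S0 : S 0 by split; rewrite ?lexx.
have ubS : ubound S t by move=> u [/andP[]].
have hS : has_sup S by split; [exists 0|exists t].
pose c := sup S.
have c0 : 0 <= c by apply: (sup_upper_bound hS).
have ct : c <= t by apply: ge_sup => //; exists 0.
have g1 : `|g| = 1 by case: gE => ->; rewrite ?normrN normr1.
have ec : 0 <= g * e (x c).
  rewrite leNgt; apply/negP => ec.
  have [d1 d10 h1] := e_cont (x c) (h := - (g * e (x c))) ltac:(rewrite oppr_gt0 //).
  have [d2 d20 h2] := ac_continuous acx d10.
  have [s [/andP[s0 st] es] cs] := sup_adherent d20 hS.
  have sc : s <= c by apply: (sup_upper_bound hS); split=> //; rewrite s0 st.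
  have /h1 : `|x s - x c| < d1.
    apply: h2; rewrite ?c0 ?s0 ?(le_trans ct) ?(le_trans st) //.
    by rewrite ler0_norm ?subr_le0 // opprB ltrBlDl -ltrBlDr.
  rewrite -(mul1r `|_|) -g1 -normrM mulrBr => /ltr_normlP[_].
  by rewrite ltrBlDr addNr ltNge es.
have neg u : c < u < t -> 0 <= - g * e (x u).
  move=> /andP[cu ut]; rewrite mulNr oppr_ge0 leNgt; apply/negP => eu.
  have : u <= c.
    apply: (sup_upper_bound hS); split; last exact: ltW.
    by apply/andP; split; [exact: le_trans c0 (ltW cu)|exact: ltW].
  by rewrite leNgt cu.
have gE' : - g = 1 \/ - g = -1 by case: gE => ->; [right|left; rewrite opprK].
have [m1 m2] := sign_order gE' sol c0 ct tT neg.
have := excess_order gE' m1 m2; rewrite !mulNr opprK => h.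
have h1 : 0 <= `|(x t).1 - (x c).1| * q1 by rewrite mulr_ge0 // ltW.
have h2 : 0 <= `|(x t).2 - (x c).2| * q2 by rewrite mulr_ge0 // ltW.
have : g * e (x c) <= g * e (x t).
  by rewrite -subr_ge0 addrC (le_trans _ h) // addr_ge0.
by move=> /(le_trans ec); rewrite leNgt et.
Qed.

(** Both prices are monotone, so their total displacement is paid for by the change
    of e, which moves towards 0 without crossing it. *)
Lemma trajectory_bound x T t : solution_upto D f T x -> 0 <= t <= T ->
  `|(x t).1 - (x 0).1| * q1 + `|(x t).2 - (x 0).2| * q2 <= `|e (x 0)|.
Proof.
move=> sol tT; have /andP[t0 t_T] := tT.
have [g gE ge] : exists2 g : R, g = 1 \/ g = -1 & `|e (x 0)| = g * e (x 0).
  have [h|h] := le_or_lt 0 (e (x 0)).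
    by exists 1; [left|rewrite mul1r ger0_norm].
  by exists (-1); [right|rewrite mulN1r ltr0_norm].
have pos u : 0 <= u <= T -> 0 <= g * e (x u).
  by apply: sign_invariant => //; rewrite -ge.
have [|m1 m2] := sign_order gE sol (lexx 0) t0 t_T.
  by move=> u /andP[u0 ut]; apply: pos; rewrite !ltW // (lt_le_trans ut).
apply: (le_trans (excess_order gE m1 m2)).
by rewrite ge lerBlDr lerDl pos.
Qed.

End signed.
End trajectories.

(** * The price field *)

Section market.
Variable R : realType.
Variables q1 q2 Y1 Y2 rho : R.
Hypotheses (q1_gt0 : 0 < q1) (q2_gt0 : 0 < q2) (Y1_gt0 : 0 < Y1) (Y2_gt0 : 0 < Y2).
Hypothesis rho_gt0 : 0 < rho.
Notation D := (@nonneg_prices R).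
Notation F := (price_field q1 q2 Y1 Y2 rho).

Definition excess (p : plane R) : R :=
  surplus rho q1 Y1 p.1 + surplus rho q2 Y2 p.2.

Lemma nash_the_nash p : D p -> nash q1 q2 Y1 Y2 rho p (the_nash q1 q2 Y1 Y2 rho p).
Proof. by move=> Dp; apply: xgetPex; exact: nash_exists. Qed.

Definition weighted (v : plane R) : R := q1 * v.1 + q2 * v.2.

(** The velocities are those of [trade_balance], up to the factors q1 and q2, and
    the bounds on the imports hold at every Nash equilibrium. *)
Lemma price_field_sign : exists2 c : R, 0 < c & forall p, D p ->
  (0 <= excess p -> [/\ 0 <= (F p).1, 0 <= (F p).2 & weighted (F p) = excess p]) /\
  (excess p <= 0 -> [/\ (F p).1 <= 0, (F p).2 <= 0 &
     excess p <= weighted (F p) <= c * excess p]).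
Proof.
pose c1 := Y1 / (Y1 + rho * q1); pose c2 := Y2 / (Y2 + rho * q2).
have d1 : 0 < Y1 + rho * q1 by rewrite addr_gt0 ?mulr_gt0.
have d2 : 0 < Y2 + rho * q2 by rewrite addr_gt0 ?mulr_gt0.
pose c := Num.min c1 c2.
have c_gt0 : 0 < c by rewrite lt_min !divr_gt0.
exists c => // p Dp; have [N1 N2] := nash_the_nash Dp.
have /best_reply1P := N1; move/(_ q1_gt0 Y1_gt0 rho_gt0 Dp) => g1.
have /best_reply2P := N2; move/(_ q2_gt0 Y2_gt0 rho_gt0 Dp) => g2.
have [p1_ge0 p2_ge0] : 0 <= (p.1 : R) /\ 0 <= (p.2 : R) by [].
have [b0 bk alt1] :=
  nash_imports q1_gt0 q2_gt0 Y1_gt0 Y2_gt0 rho_gt0 p1_ge0 p2_ge0 g1 g2.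
have [a0 ak alt2] :=
  nash_imports q2_gt0 q1_gt0 Y2_gt0 Y1_gt0 rho_gt0 p2_ge0 p1_ge0 g2 g1.
have hc1 : c * (Y1 + rho * q1) <= Y1.
  by rewrite -ler_pdivlMr // ge_min lexx.
have hc2 : c * (Y2 + rho * q2) <= Y2.
  by rewrite -ler_pdivlMr // ge_min lexx orbT.
have := trade_balance q1_gt0 q2_gt0 Y1_gt0 Y2_gt0 rho_gt0 p1_ge0 p2_ge0 c_gt0
  hc1 hc2 _ _ alt1 alt2.
rewrite b0 bk a0 ak => /(_ isT isT).
rewrite -/(excess p).
set s := the_nash q1 q2 Y1 Y2 rho p.
set V1 := (X in [/\ 0 <= X, _ & _]); set V2 := (X in [/\ _, 0 <= X & _]).
have velE (q Y x z al be ga : R) : 0 < q ->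
    q * (- x * ((q - (al + ga)) / q) + (Y - (x * al + z * be)) / q) =
    Y - x * q + x * ga - z * be.
  by move=> q0; field; exact: lt0r_neq0.
have e1 : q1 * (F p).1 = V1.
  exact: (velE q1 Y1 p.1 (p.2 + rho) s.1.1 s.1.2 s.2.1 q1_gt0).
have e2 : q2 * (F p).2 = V2.
  rewrite /= /q2cons /Y2cons /cost2 -/s (addrC s.1.2) (addrC (_ * s.2.1)).
  exact: (velE q2 Y2 p.2 (p.1 + rho) s.2.2 s.2.1 s.1.2 q2_gt0).
rewrite /weighted -(pmulr_rge0 (F p).1 q1_gt0) -(pmulr_rge0 (F p).2 q2_gt0).
rewrite -(pmulr_rle0 (F p).1 q1_gt0) -(pmulr_rle0 (F p).2 q2_gt0) e1 e2.
by case=> hp hn; split=> [/hp|/hn] [? ? ?]; split.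
Qed.

Lemma excess_eq0 p : D p -> excess p = 0 <-> F p = 0.
Proof.
move=> Dp; have [c c0 /(_ _ Dp)[hp hn]] := price_field_sign.
split=> [e0|F0].
  move: hp hn; rewrite e0 lexx => /(_ isT)[f1 f2 _] /(_ isT)[g1 g2 _].
  by apply/pair_equal_spec; split; apply/eqP; rewrite eq_le ?f1 ?f2 ?g1 ?g2.
move: hp hn; rewrite F0 /weighted /= !mulr0 addr0.
have [e0|e0] := le_or_lt 0 (excess p); first by move=> /(_ e0)[].
move=> _ /(_ (ltW e0))[_ _ /andP[_]].
by rewrite pmulr_rge0 // leNgt e0.
Qed.

Lemma continuous_excess : continuous excess.
Proof.
move=> p; apply: (@cvgD R R^o).
  by apply: (cvg_comp _ _ cvg_fst); exact: continuous_surplus.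
by apply: (cvg_comp _ _ cvg_snd); exact: continuous_surplus.
Qed.

Lemma surplus_sign q Y p : 0 < q -> 0 < Y ->
  [/\ p < Y / q -> 0 < surplus rho q Y p,
      p = Y / q -> surplus rho q Y p = 0 &
      Y / q < p -> surplus rho q Y p < 0].
Proof.
move=> q0 Y0; have E0 : surplus rho q Y (Y / q) = 0.
  by rewrite /surplus divfK ?gt_eqF // shortfall_eq0 ?divfK ?gt_eqF //; ring.
split=> [h|->//|h].
- have := surplus_gap q0 Y0 rho_gt0 (ltW h); rewrite E0 subr0.
  by apply: lt_le_trans; rewrite mulr_gt0 // subr_gt0.
- have := surplus_gap q0 Y0 rho_gt0 (ltW h); rewrite E0 sub0r => g.
  by rewrite -oppr_gt0; apply: lt_le_trans g; rewrite mulr_gt0 // subr_gt0.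
Qed.

Lemma surplusE_high q Y p : 0 < q -> 0 < Y -> Y / q < p ->
  surplus rho q Y p = Y - p * q - rho * (q - Y / p).
Proof. by move=> q0 Y0 h; rewrite /surplus /shortfall max_l // ltW. Qed.

Lemma surplusE_low q Y p : 0 < q -> 0 < Y -> p < Y / q ->
  surplus rho q Y p = Y - p * q.
Proof.
move=> q0 Y0 h; rewrite /surplus shortfall_eq0 ?mulr0 ?subr0 //.
by rewrite -ler_pdivlMr // ltW.
Qed.

Lemma eq_mulV (q x y : R) : 0 < q -> x = q^-1 * y <-> q * x = y.
Proof.
move=> q0; have q_neq0 := lt0r_neq0 q0.
by split=> [->|<-]; rewrite ?mulVKf ?mulKf.
Qed.

(** The surplus of region i has the sign of Y_i / q_i - p_i, so at a zero of the
    excess the two surpluses have opposite signs, which gives the two arcs, or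
    both vanish, which gives their common point. *)
Lemma excess_zeros :
  [set p | D p /\ excess p = 0] = arc3 q1 q2 Y1 Y2 rho `|` arc4 q1 q2 Y1 Y2 rho
    `|` [set Etilde q1 q2 Y1 Y2].
Proof.
apply/seteqP; split=> [[p1 p2] [[/= p1_ge0 p2_ge0]]|[p1 p2]]; rewrite /excess /=.
  have [h1 h2 h3] := surplus_sign p1 q1_gt0 Y1_gt0.
  have [k1 k2 k3] := surplus_sign p2 q2_gt0 Y2_gt0.
  have [l1|l1|l1] := ltgtP p1 (Y1 / q1); have [l2|l2|l2] := ltgtP p2 (Y2 / q2).
  - by move=> e; exfalso; have := h1 l1; have := k1 l2; lra.
  - move=> e; left; left; split=> //=; last by rewrite p1_ge0.
    move: e; rewrite surplusE_low // surplusE_high // => e.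
    by apply/eq_mulV => //; lra.
  - by move=> e; exfalso; have := h1 l1; have := k2 l2; lra.
  - move=> e; left; right; split=> //=; last by rewrite p2_ge0.
    move: e; rewrite surplusE_high // surplusE_low // => e.
    by apply/eq_mulV => //; lra.
  - by move=> e; exfalso; have := h3 l1; have := k3 l2; lra.
  - by move=> e; exfalso; have := h3 l1; have := k2 l2; lra.
  - by move=> e; exfalso; have := h2 l1; have := k1 l2; lra.
  - by move=> e; exfalso; have := h2 l1; have := k3 l2; lra.
  - by move=> _; right; rewrite /Etilde /= l1 l2.
case=> [[]|[-> ->]].
- case=> /= e /andP[p1_ge0 l1] l2; split; first split=> //=.
    by apply: le_trans (ltW l2); rewrite divr_ge0 // ltW.
  move: e => /(eq_mulV _ _ q1_gt0) e.
  by rewrite surplusE_low // surplusE_high //; lra.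
- case=> /= e l1 /andP[p2_ge0 l2]; split; first split=> //=.
    by apply: le_trans (ltW l1); rewrite divr_ge0 // ltW.
  move: e => /(eq_mulV _ _ q2_gt0) e.
  by rewrite surplusE_high // surplusE_low //; lra.
- split; first by split; rewrite /= divr_ge0 // ltW.
  have [_ -> // _] := surplus_sign (Y1 / q1) q1_gt0 Y1_gt0.
  by have [_ -> // _] := surplus_sign (Y2 / q2) q2_gt0 Y2_gt0; rewrite addr0.
Qed.

Lemma Etilde_on_hyperbolae :
  let p := Etilde q1 q2 Y1 Y2 in
  p.1 = h3 q1 q2 Y1 Y2 rho p.2 /\ p.2 = h4 q1 q2 Y1 Y2 rho p.1.
Proof.
have [Y1_neq0 Y2_neq0] := (lt0r_neq0 Y1_gt0, lt0r_neq0 Y2_gt0).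
have [q1_neq0 q2_neq0] := (lt0r_neq0 q1_gt0, lt0r_neq0 q2_gt0).
by split; rewrite /h3 /h4 /=; field; rewrite ?Y1_neq0 ?Y2_neq0 ?q1_neq0 ?q2_neq0.
Qed.

(** * Equilibria and their stability *)

Lemma excess_cont p h : 0 < h -> exists2 d, 0 < d &
  forall q, `|q - p| < d -> `|excess q - excess p| < h.
Proof.
move=> h0; have := @continuous_excess p.
move/cvgrPdist_lt => /(_ _ h0) /nbhs_ballP[d /= d0 hd]; exists d => // q qp.
by rewrite distrC; apply: hd; rewrite -ball_normE /= distrC.
Qed.

Lemma excess_gap (p v : plane R) : p.1 <= v.1 -> p.2 <= v.2 ->
  q1 * (v.1 - p.1) + q2 * (v.2 - p.2) <= excess p - excess v.
Proof.
move=> h1 h2; rewrite /excess opprD addrACA.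
exact: lerD (surplus_gap q1_gt0 Y1_gt0 rho_gt0 h1) (surplus_gap q2_gt0 Y2_gt0 rho_gt0 h2).
Qed.

(** The two velocities have the same sign and their weighted sum is at most the
    excess in absolute value, so each is controlled by the excess, also on the
    side where it has the wrong sign. *)
Lemma field_lower g p h : g = 1 \/ g = -1 -> D p -> 0 <= h -> - h <= g * excess p ->
  - h <= q1 * (g * (F p).1) /\ - h <= q2 * (g * (F p).2).
Proof.
move=> gE Dp; have [c _ /(_ _ Dp)] := price_field_sign.
rewrite /weighted.
have : forall (f1 f2 e : R),
  (0 <= e -> [/\ 0 <= f1, 0 <= f2 & q1 * f1 + q2 * f2 = e]) /\
  (e <= 0 -> [/\ f1 <= 0, f2 <= 0 & e <= q1 * f1 + q2 * f2 <= c * e]) ->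
  0 <= h -> - h <= g * e -> - h <= q1 * (g * f1) /\ - h <= q2 * (g * f2); last by move=> H; exact: H.
move=> f1 f2 e [hp hn] h0; have [e0|e0] := le_or_lt 0 e.
  have [f10 f20 fe] := hp e0.
  have := mulr_ge0 (ltW q1_gt0) f10; have := mulr_ge0 (ltW q2_gt0) f20.
  by case: gE => -> ? ? ?; split; lra.
have [f10 f20 /andP[fe _]] := hn (ltW e0).
have : q1 * f1 <= 0 by rewrite pmulr_rle0.
have : q2 * f2 <= 0 by rewrite pmulr_rle0.
by case: gE => -> ? ? ?; split; lra.
Qed.

(** At a zero of the excess this says that 0 is the only admissible velocity: take
    both signs g. *)
Lemma filippov_sign g p v : g = 1 \/ g = -1 -> D p -> filippov D F p v ->
  0 <= g * excess p -> 0 <= g * v.1 /\ 0 <= g * v.2.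
Proof.
move=> gE Dp fv ge.
have near h : 0 < h -> exists2 d, 0 < d & forall q, `|q - p| < d -> D q ->
    - h <= q1 * (g * (F q).1) /\ - h <= q2 * (g * (F q).2).
  move=> h0; have [d d0 hd] := excess_cont p h0; exists d => // q qp Dq.
  apply: field_lower => //; first exact: ltW.
  have /ltr_normlP[n1 n2] := hd _ qp.
  by move: ge; case: gE => ->; lra.
split; rewrite leNgt; apply/negP => neg.
- have h0 : 0 < - (q1 * (g * v.1)) / 2 by rewrite divr_gt0 // oppr_gt0 pmulr_rlt0.
  have [d d0 hd] := near _ h0.
  have := @filippov_halfplane R D F (q1 * g) 0 (- (- (q1 * (g * v.1)) / 2)) d p v d0.
  rewrite /lin mul0r addr0 => /(_ _ fv).
  have -> : q1 * g * v.1 = q1 * (g * v.1) by rewrite mulrA.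
  move: (q1 * (g * v.1)) h0 hd => z h0 hd h.
  suff : - (- z / 2) <= z by lra.
  by apply: h => q qp Dq; rewrite mul0r addr0 -mulrA; case: (hd q qp Dq).
- have h0 : 0 < - (q2 * (g * v.2)) / 2 by rewrite divr_gt0 // oppr_gt0 pmulr_rlt0.
  have [d d0 hd] := near _ h0.
  have := @filippov_halfplane R D F 0 (q2 * g) (- (- (q2 * (g * v.2)) / 2)) d p v d0.
  rewrite /lin mul0r add0r => /(_ _ fv).
  have -> : q2 * g * v.2 = q2 * (g * v.2) by rewrite mulrA.
  move: (q2 * (g * v.2)) h0 hd => z h0 hd h.
  suff : - (- z / 2) <= z by lra.
  by apply: h => q qp Dq; rewrite mul0r add0r -mulrA; case: (hd q qp Dq).
Qed.

(** Near a point where the excess is not 0, the field lies on one side of a line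
    that does not contain 0. *)
Lemma filippov_zero_excess p : D p -> filippov D F p 0 -> excess p = 0.
Proof.
move=> Dp f0.
have [c c0 sgn] := price_field_sign.
apply: contrapT => /eqP; rewrite neq_lt => /orP[e0|e0].
- have h0 : 0 < - excess p / 2 by lra.
  have [d d0 hd] := excess_cont p h0.
  have := @filippov_halfplane R D F (- q1) (- q2) (c * (- excess p / 2)) d p 0 d0.
  rewrite /lin !mulr0 addr0 => /(_ _ f0) h.
  have : c * (- excess p / 2) <= 0.
    apply: h => q qp Dq; have /ltr_normlP[_ n2] := hd _ qp.
    have eq0 : excess q <= 0 by lra.
    have [_ /(_ eq0)[_ _ /andP[_]]] := sgn _ Dq.
    have : c * excess q <= c * (excess p / 2) by rewrite ler_pM2l //; lra.
    rewrite /weighted !mulNr -opprD.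
    move: (q1 * _ + q2 * _) => w; lra.
  by rewrite pmulr_rle0 //; lra.
- have h0 : 0 < excess p / 2 by lra.
  have [d d0 hd] := excess_cont p h0.
  have := @filippov_halfplane R D F q1 q2 (excess p / 2) d p 0 d0.
  rewrite /lin !mulr0 addr0 => /(_ _ f0) h.
  have : excess p / 2 <= 0; last by lra.
  apply: h => q qp Dq; have /ltr_normlP[n1 _] := hd _ qp.
  have eq0 : 0 <= excess q by lra.
  have [/(_ eq0)[_ _ hw] _] := sgn _ Dq.
  by move: hw; rewrite /weighted => ->; lra.
Qed.

Lemma excess_zero_filippov p : D p -> excess p = 0 -> filippov D F p 0.
Proof.
move=> Dp e0; apply: filippov_zero => //.
move=> h h0; pose m := Num.min q1 q2 * h / 2.
have mq : 0 < Num.min q1 q2 by rewrite lt_min q1_gt0.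
have m0 : 0 < m by rewrite /m !divr_gt0 ?mulr_gt0.
have [d d0 hd] := excess_cont p m0; exists d => // q qp Dq.
have /ltr_normlP[] := hd _ qp; rewrite e0 subr0 => n1 n2.
have [a1 a2] : - m <= q1 * (1 * (F q).1) /\ - m <= q2 * (1 * (F q).2).
  by apply: field_lower; [left| |exact: ltW|lra].
have [b1 b2] : - m <= q1 * (- 1 * (F q).1) /\ - m <= q2 * (- 1 * (F q).2).
  by apply: field_lower; [right| |exact: ltW|lra].
have small (r z : R) : 0 < r -> Num.min q1 q2 <= r -> - m <= r * (1 * z) ->
    - m <= r * (-1 * z) -> `|z| < h.
  move=> r0 mr k1 k2.
  have mlt : m < r * h.
    have : Num.min q1 q2 * h <= r * h by rewrite ler_pM2r.
    have : 0 < r * h by apply: mulr_gt0.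
    by rewrite /m; lra.
  apply/ltr_normlP; split; rewrite -(ltr_pM2l r0); lra.
rewrite plane_norm_lt; apply/andP; split.
  by apply: (small q1) => //; rewrite ge_min lexx.
by apply: (small q2) => //; rewrite ge_min lexx orbT.
Qed.

Lemma excess_zero_stable p : excess p = 0 -> lyapunov_stable D F p.
Proof.
move=> e0 h h0; pose m := Num.min q1 q2 * h / 2.
have mq : 0 < Num.min q1 q2 by rewrite lt_min q1_gt0.
have m0 : 0 < m by rewrite /m !divr_gt0 ?mulr_gt0.
have [d d0 hd] := excess_cont p m0.
exists (Num.min d (h / 2)); first by rewrite lt_min d0 divr_gt0.
move=> T x sol; rewrite lt_min => /andP[/hd + x0] t tT; rewrite e0 subr0 => ex.
have bd := trajectory_bound q1_gt0 q2_gt0 excess_cont excess_gap filippov_sign sol tT.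
have small (r s y z : R) : 0 < r -> 0 <= s -> Num.min q1 q2 <= r ->
    `|z| * r + s <= `|excess (x 0)| -> `|z| < h / 2.
  move=> r0 s0 mr k.
  have : Num.min q1 q2 * `|z| <= r * `|z| by rewrite ler_wpM2r.
  by rewrite -(ltr_pM2l mq) => ?; move: ex; rewrite /m; lra.
have b1 : 0 <= `|(x t).1 - (x 0).1| * q1 by rewrite mulr_ge0 // ltW.
have b2 : 0 <= `|(x t).2 - (x 0).2| * q2 by rewrite mulr_ge0 // ltW.
have xt : `|x t - x 0| < h / 2.
  rewrite plane_norm_lt; apply/andP; split.
    by apply: (small q1 _ 0 _ q1_gt0 b2 _ bd); rewrite ge_min lexx.
  by apply: (small q2 _ 0 _ q2_gt0 b1 _ _); rewrite ?ge_min ?lexx ?orbT // addrC.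
exact: (@distm_lt_split _ _ (x 0)).
Qed.

Lemma segment_zero (A B : plane R) : 0 <= excess A -> excess B <= 0 ->
  exists2 t, 0 <= t <= 1 & excess (A + t *: (B - A)) = 0.
Proof.
move=> eA eB.
have cg : continuous (fun t : R => excess (A + t *: (B - A))).
  move=> t; apply: (cvg_comp (fun t : R => A + t *: (B - A)) excess);
    last exact: continuous_excess.
  by apply: cvgD; [exact: cvg_cst|apply: cvgZ; [exact: cvg_id|exact: cvg_cst]].
have [||t t01 et] := @IVT R (fun t => excess (A + t *: (B - A))) 0 1 0 ler01.
- exact: continuous_subspaceT.
- rewrite scale0r addr0 scale1r addrC subrK.
  by rewrite ge_min le_max eA eB orbT.
by exists t.
Qed.

Lemma excess_decr (p v : plane R) :
  p.1 <= v.1 -> p.2 <= v.2 -> p != v -> excess v < excess p.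
Proof.
move=> h1 h2; rewrite !ltNge; apply: contra => le_e.
have gap := le_trans (excess_gap h1 h2) (_ : _ <= 0).
have {}gap : q1 * (v.1 - p.1) + q2 * (v.2 - p.2) <= 0 by apply: gap; rewrite subr_le0.
have k1 : 0 <= q1 * (v.1 - p.1) by rewrite mulr_ge0 ?subr_ge0 // ltW.
have k2 : 0 <= q2 * (v.2 - p.2) by rewrite mulr_ge0 ?subr_ge0 // ltW.
have : q1 * (v.1 - p.1) <= 0 by apply: le_trans gap; rewrite lerDl.
have : q2 * (v.2 - p.2) <= 0 by apply: le_trans gap; rewrite lerDr.
rewrite !pmulr_rle0 // !subr_le0 => l2 l1.
apply/eqP; rewrite (surjective_pairing p) (surjective_pairing v).
by apply/pair_equal_spec; split; apply/eqP; rewrite eq_le ?h1 ?h2 ?l1 ?l2.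
Qed.

(** Lower one price by r, which makes the excess positive, or raise the other one
    by r, which makes it negative; there is a zero on the segment in between.  The
    first price is lowered if a = 1; at the ends of the curve one of the prices is
    0, so either choice of a may be needed. *)
Lemma excess_zero_nearby p (a r : R) : a = 0 \/ a = 1 -> 0 < r ->
  D p -> excess p = 0 -> a * r <= p.1 -> (1 - a) * r <= p.2 ->
  exists p', [/\ D p', excess p' = 0, p' != p & `|p' - p| <= r].
Proof.
case: p => [x y] aE r0 [/= x0 y0] e0 ax ay.
pose A : plane R := (x - a * r, y - (1 - a) * r).
pose B : plane R := (x + (1 - a) * r, y + a * r).
have [a0 a1] : 0 <= a * r /\ 0 <= (1 - a) * r.
  by case: aE => ->; split; lra.
have pA : A != (x, y).
  by apply/eqP => -[]; case: aE => -> *; lra.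
have pB : (x, y) != B :> plane R.
  by apply/eqP => -[]; case: aE => -> *; lra.
have eA : 0 <= excess A by rewrite -e0 ltW // excess_decr //= gerBl.
have eB : excess B <= 0 by rewrite -e0 ltW // excess_decr //= lerDl.
have [t /andP[t0 t1] et] := segment_zero eA eB.
have zE : A + t *: (B - A) = (x + (t - a) * r, y + (t - (1 - a)) * r).
  have E (x' y' : R) : x' - a * r + t * (x' + (1 - a) * r - (x' - a * r)) = x' + (t - a) * r /\
     y' - (1 - a) * r + t * (y' + a * r - (y' - (1 - a) * r)) = y' + (t - (1 - a)) * r.
    by split; ring.
  have [E1 E2] := E x y.
  by apply/pair_equal_spec; split.
exists (A + t *: (B - A)); rewrite et zE; split=> //.
- have : 0 <= t * r by apply: mulr_ge0 => //; exact: ltW.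
  by move=> tr; split; rewrite /= mulrBl; lra.
- have same (z w : R) : z + w * r = z -> w = 0.
    by move=> h; apply: (mulIf (lt0r_neq0 r0)); rewrite mul0r; lra.
  by apply/eqP => -[/same t_a /same t_b]; case: aE => aE; lra.
- have small (w : R) : - 1 <= w -> w <= 1 -> `|w * r| <= r.
    by move=> w1 w2; rewrite normrM (gtr0_norm r0) ler_piMl ?(ltW r0) // ler_norml w1 w2.
  rewrite prod_normE /= ge_max !(addrC _ (_ * r)) !addrK.
  by apply/andP; split; apply: small; case: aE => ->; lra.
Qed.

Lemma excess_zero_not_isolated p d : D p -> excess p = 0 -> 0 < d ->
  exists p', [/\ D p', excess p' = 0, p' != p & `|p' - p| < d].
Proof.
move=> Dp e0 d0.
have [a [r [aE r0 rd h1 h2]]] : exists a r : R,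
    [/\ a = 0 \/ a = 1, 0 < r, r < d, a * r <= p.1 & (1 - a) * r <= p.2].
  have [p1 p2] : 0 <= (p.1 : R) /\ 0 <= (p.2 : R) by [].
  have pick (z : R) : 0 < z -> exists2 r, 0 < r & r < d /\ r <= z.
    move=> z0; exists (Num.min (d / 2) z); first by rewrite lt_min z0 divr_gt0.
    by split; rewrite ?gt_min ?ge_min ?lexx ?orbT // ltr_pdivrMr // ltr_pMr // ltr1n.
  have [p1_le0|/pick[r r0 [rd rp]]] := le_or_lt p.1 0; last first.
    by exists 1, r; split=> //; [right|rewrite mul1r|rewrite subrr mul0r].
  have [p2_le0|/pick[r r0 [rd rp]]] := le_or_lt p.2 0; last first.
    by exists 0, r; split=> //; [left|rewrite mul0r|rewrite subr0 mul1r].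
  exfalso; move: e0; rewrite /excess /surplus.
  have -> : p.1 = 0 :> R by lra.
  have -> : p.2 = 0 :> R by lra.
  rewrite !shortfall_eq0 ?mul0r ?ltW //.
  by have := Y1_gt0; have := Y2_gt0; lra.
have [p' [Dp' e' p'p np]] := excess_zero_nearby aE r0 Dp e0 h1 h2.
by exists p'; split=> //; exact: le_lt_trans rd.
Qed.

Lemma constant_solution p : D p -> filippov D F p 0 -> solution D F (fun=> p).
Proof.
move=> Dp f0 T T0; split=> //.
  move=> e e0; exists 1 => // n s t _ _ _.
  by rewrite big1 // => i _; rewrite subrr normr0.
apply: aeW => t _; exists 0 => //; exact: is_derive_cst.
Qed.

Lemma excess_zero_not_attractive p : D p -> excess p = 0 -> ~ attractive D F p.
Proof.
move=> Dp e0 [d d0 hd].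
have [p' [Dp' e' p'p np]] := excess_zero_not_isolated Dp e0 d0.
have := hd _ (constant_solution Dp' (excess_zero_filippov Dp' e')) np.
move=> /cvg_unique; move/(_ _ p') => h.
by move: p'p; rewrite h ?eqxx //; exact: cvg_cst.
Qed.

End market.

Theorem mainTheorem6 (R : realType) (q1 q2 Y1 Y2 rho : R)
  (q1_gt0 : 0 < q1) (q2_gt0 : 0 < q2) (Y1_gt0 : 0 < Y1) (Y2_gt0 : 0 < Y2)
  (rho_gt0 : 0 < rho) :
  let D := @nonneg_prices R in
  let F := price_field q1 q2 Y1 Y2 rho in
  let E0 := Etilde q1 q2 Y1 Y2 in
  let E := arc3 q1 q2 Y1 Y2 rho `|` arc4 q1 q2 Y1 Y2 rho `|` [set E0] in
  [/\ zeros D F = E,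
      filippov_equilibria D F = E,
      E0.1 = h3 q1 q2 Y1 Y2 rho E0.2 /\ E0.2 = h4 q1 q2 Y1 Y2 rho E0.1,
      forall p, E p -> lyapunov_stable D F p /\ ~ asymptotically_stable D F p &
      ~ asymptotically_stable D F E0].
Proof.
move=> D F E0 E.
have zE : [set p | D p /\ excess q1 q2 Y1 Y2 rho p = 0] = E.
  exact: excess_zeros.
have inE' p : E p -> D p /\ excess q1 q2 Y1 Y2 rho p = 0 by rewrite -zE.
have notAS p : E p -> ~ asymptotically_stable D F p.
  by move=> /inE'[Dp e0] [_]; exact: excess_zero_not_attractive.
split.
- rewrite -zE; apply/seteqP; split=> p [Dp]; split=> //; exact/excess_eq0.
- rewrite -zE; apply/seteqP; split=> p [Dp h]; split=> //.
    exact: (filippov_zero_excess q1_gt0 q2_gt0 Y1_gt0 Y2_gt0 rho_gt0).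
  exact: (excess_zero_filippov q1_gt0 q2_gt0 Y1_gt0 Y2_gt0 rho_gt0).
- exact: Etilde_on_hyperbolae.
- move=> p Ep; split; last exact: notAS.
  by have [_ e0] := inE' p Ep; exact: excess_zero_stable.
- by apply: notAS; right.
Qed.
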